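(* Let $\alpha>-1$, let $N\ge0$ be an integer and let $M_0,\dots,M_N\ge0$. Let $\{b_j(n)\}_{j=0}^{N+1}$ be the coefficients in the representation $$q_n(x)=\sum_{j=0}^{N+1}b_j(n)\,x^j\,l_{n-j}^{\alpha+2j}(x)$$ of the orthonormal discrete Laguerre–Sobolev polynomials $q_n$ in terms of orthonormal Laguerre polynomials. Then for every $j\in\{0,\dots,N+1\}$ the limit $$\lim_{n\to\infty} b_j(n)=b_j\in\mathbb{R}$$ exists. Moreover, the first index $j$ such that $b_j\ne0$ is the first index $j$ such that $M_j=0$ (where, if all the masses $M_0,\dots,M_N$ are positive, this is understood to mean that the unique coefficient $b_j$ different from zero is the last one, $b_{N+1}$).
   Context: For $\gamma>-1$, $L_n^\gamma$ is the Laguerre polynomial of degree $n$, orthogonal on $[0,\infty)$ with respect to the probability measure $\frac{1}{\Gamma(\gamma+1)}x^\gamma e^{-x}dx$ and normalized by $L_n^\gamma(0)=\binom{n+\gamma}{n}$; $l_n^\gamma=L_n^\gamma/\Vert L_n^\gamma\Vert$ is the orthonormal one, where $\Vert L_n^\gamma\Vert^2=\frac{1}{\Gamma(\gamma+1)}\int_0^\infty L_n^\gamma(x)^2x^\gamma e^{-x}dx=\frac{\Gamma(n+\gamma+1)}{n!\,\Gamma(\gamma+1)}$. The inner product is $$\langle p,q\rangle_S=\frac{1}{\Gamma(\alpha+1)}\int_0^\infty p(x)q(x)x^\alpha e^{-x}\,dx+\sum_{j=0}^N M_j p^{(j)}(0)q^{(j)}(0).$$ $Q_n$ is the polynomial of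 degree $n$ orthogonal with respect to $\langle\cdot,\cdot\rangle_S$ with the same leading coefficient as $L_n^\alpha$, and $q_n=\langle Q_n,Q_n\rangle_S^{-1/2}Q_n$. It is a known fact (Koekoek) that $q_n$ admits a representation $q_n(x)=\sum_{j=0}^{N+1}b_j(n)x^jl_{n-j}^{\alpha+2j}(x)$ with real coefficients $b_j(n)$; for $n\ge N+1$ these coefficients are uniquely determined. *)

(* Defs.v *)
From HB Require Import structures.
From mathcomp Require Import all_boot all_order all_algebra.
From mathcomp Require Import all_classical all_reals all_analysis.

Set Implicit Arguments.
Unset Strict Implicit.
Unset Printing Implicit Defensive.

Import Order.TTheory GRing.Theory Num.Theory.
Import numFieldNormedType.Exports.

Local Open Scope classical_set_scope.
Local Open Scope ring_scope.

(* The Gamma function (for z > 0, the only arguments used). *)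
Definition Gamma (R : realType) (z : R) : R :=
  \int[lebesgue_measure]_(x in `[0, +oo[) (x `^ (z - 1) * expR (- x)).

(* The real binomial coefficient x (x - 1) ... (x - n + 1) / n!. *)
Definition gbinom (R : realType) (x : R) (n : nat) : R :=
  (\prod_(i < n) (x - i%:R)) / (n`!)%:R.

(* The case distinction of powR at x = 0 is immaterial: {0} is a null set. *)
Definition laguerre_ip (R : realType) (g : R) (p q : {poly R}) : R :=
  (Gamma (g + 1))^-1 *
  \int[lebesgue_measure]_(x in `[0, +oo[) (p.[x] * q.[x] * x `^ g * expR (- x)).

Definition sobolev_ip (R : realType) (a : R) (N : nat) (M : 'I_N.+1 -> R)
    (p q : {poly R}) : R :=
  laguerre_ip a p q + \sum_(j < N.+1) M j * p^`(j).[0] * q^`(j).[0].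

Definition is_orthopoly (R : realType) (ip : {poly R} -> {poly R} -> R)
    (n : nat) (p : {poly R}) : Prop :=
  size p = n.+1 /\ forall q : {poly R}, (size q <= n)%N -> ip p q = 0.

Definition is_laguerre (R : realType) (g : R) (n : nat) (p : {poly R}) : Prop :=
  is_orthopoly (laguerre_ip g) n p /\ p.[0] = gbinom (n%:R + g) n.

Definition is_sobolev_laguerre (R : realType) (a : R) (N : nat)
    (M : 'I_N.+1 -> R) (L : {poly R}) (n : nat) (p : {poly R}) : Prop :=
  is_orthopoly (sobolev_ip a M) n p /\ lead_coef p = lead_coef L.

Definition normalize (R : realType) (ip : {poly R} -> {poly R} -> R)
    (p : {poly R}) : {poly R} :=
  (Num.sqrt (ip p p))^-1 *: p.

Definition is_first (n : nat) (P : 'I_n -> Prop) (j : 'I_n) : Prop :=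
  P j /\ forall i : 'I_n, (i < j)%N -> ~ P i.

(* Main.v *)
Require Import Defs.
From HB Require Import structures.
From mathcomp Require Import all_boot all_order all_algebra.
From mathcomp Require Import all_classical all_reals all_analysis.
From mathcomp Require Import measurable_realfun.
From mathcomp Require Import ring lra zify.

Set Implicit Arguments.
Unset Strict Implicit.
Unset Printing Implicit Defensive.

Import Order.TTheory GRing.Theory Num.Theory.
Import numFieldNormedType.Exports.

Local Open Scope classical_set_scope.
Local Open Scope ring_scope.

(** After a suitable rescaling, the coefficients b_j(n) solve a linear system
    that converges to a nonsingular one as n grows.

    Write a for alpha, and let l be the Laguerre polynomial of degree n - j and
    parameter a + 2j.  The moments of x^j l and its Taylor coefficients at 0
    are finite differences of quotients of Gamma values, hence explicit
    ([gamma_ratio_diff]).  For fixed k their dependence on n is the same for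
    all j, up to factors tending to 1.  So there are constants sigma_j > 0 and
    ratios eps_j(n) tending to 1 such that, with
      beta_j = (-1)^j sigma_j b_j / sqrt(eps_j),
    orthogonality of q_n to x^k for k <= N reads ([rescaled_system_row])
      C_k(beta) + M_k w_k(n) D_k(eps beta) = 0.
    Here C_k ([moment_form]) only involves the beta_j with j > k, and D_k
    ([taylor_form]) only those with j <= k.  Neither depends on n, and |w_k(n)|
    tends to infinity.  Since q_n has norm 1, the product of its leading
    coefficient and of its inner product with x^n is 1, which reads
    ([rescaled_system_norm])
      (sum_j beta_j) (sum_j eps_j beta_j) = 1.
    In the limit C_k = 0 if M_k = 0, D_k = 0 if M_k > 0, and the beta_j add up
    to 1.  Once this limit system is known to be nonsingular, Cramer's rule
    gives the convergence ([rescaled_coef_cvg]).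

    The limit system is nonsingular because D_k C_k = 0 for all k.  Suppose
    that the beta_j add up to 0, and let s_j be their partial sums.  Then D_k
    and C_k are the images of the vector (a + 1 + 2j) s_j under two triangular
    matrices that are inverse to each other up to signs and a diagonal factor
    ([dual_orthogonality], one more instance of [gamma_ratio_diff]).  Hence
      sum_k (-1)^k D_k C_k = sum_j (a + 1 + 2j) s_j^2,
    and all s_j vanish ([sum_zero_trivial]).  Analytically, near 0 the q_n
    approach a combination f of Bessel functions, and the identity computes
    the integral of f^2 x^a from Taylor coefficients and moments of f.

    Let k0 be the first index with M_k0 = 0.  For k < k0 the equations D_k = 0
    are triangular and give beta_j = 0 for j < k0.  If beta_k0 were 0 as well,
    then D_k0 and C_k0 would both vanish.  In that case f x^(a + k0) has an
    antiderivative that decays fast enough for the same computation to apply,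
    which replaces the partial sums by the solution s of
      beta_j = (a + 1 + k0 + j) s_j + (j - 1 - k0) s_(j-1);
    again s = 0 ([double_zero_trivial]), contradicting sum_j beta_j = 1. *)

(** * The Gamma function *)

Lemma measurable_gamma_density (R : realType) (z : R) (D : set R) :
  measurable_fun D (fun x : R => x `^ (z - 1) * expR (- x)).
Proof.
apply: (@measurable_funS _ _ _ _ setT) => //.
apply: measurable_funM; first exact: measurable_powR.
by apply: measurableT_comp => //; exact: measurableT_comp.
Qed.

Lemma measurable_Egamma_density (R : realType) (z : R) (D : set R) :
  measurable_fun D (fun x : R => (x `^ (z - 1) * expR (- x))%:E).
Proof. by apply/measurable_EFinP; exact: measurable_gamma_density. Qed.

(** Working with the extended integral lets the functional equation be proved before
    finiteness; finiteness is then deduced from it. *)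
Definition egamma (R : realType) (z : R) : \bar R :=
  (\int[lebesgue_measure]_(x in `]0%R, +oo[) (x `^ (z - 1) * expR (- x))%:E)%E.

Lemma egamma_density_ge0 (R : realType) (z x : R) :
  (0 <= (x `^ (z - 1) * expR (- x))%:E)%E.
Proof. by rewrite lee_fin mulr_ge0 ?powR_ge0 ?expR_ge0. Qed.

Lemma egammaE (R : realType) (z : R) : egamma z =
  (\int[lebesgue_measure]_(x in `[0%R, +oo[) (x `^ (z - 1) * expR (- x))%:E)%E.
Proof.
rewrite /egamma (integral_itv_obnd_cbnd (r := 0%R) (b := +oo%O)) //.
exact: measurable_Egamma_density.
Qed.

(** The boundary terms of the integration by parts behind [egammaS]. *)
Lemma gamma_boundary_cvg (R : realType) (z : R) : 0 < z ->
  (n.+2%:R `^ z * expR (- n.+2%:R) - n.+2%:R^-1 `^ z * expR (- n.+2%:R^-1) : R)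
    @[n --> \oo] --> 0.
Proof.
move=> z0.
have inv0 : (n.+2%:R^-1 : R) @[n --> \oo] --> 0.
  by have := @cvg_harmonic R; rewrite -(cvg_shiftS (@harmonic R)).
rewrite -[0](subr0 0); apply: cvgB.
  have [m zm] : exists m : nat, z <= m%:R.
    by exists (Num.bound z); rewrite ltW// archi_boundP// ltW.
  apply: (@squeeze_cvgr _ _ _ _ (fun=> 0) (fun n => m.+1`!%:R * n.+2%:R^-1)).
  - near=> n; rewrite mulr_ge0 ?powR_ge0 ?expR_ge0//=.
    rewrite expRN ler_pdivrMr ?expR_gt0//.
    apply: (@le_trans _ _ (n.+2%:R ^+ m)).
      by rewrite -powR_mulrn// ler_powR// ler1n.
    rewrite -mulrA mulrCA ler_pdivlMl//.
    rewrite -exprS -ler_pdivrMl ?ltr0n ?fact_gt0// mulrC.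
    have := @expR_ge1Dxn R n.+2%:R m (ler0n _ _); lra.
  - exact: cvg_cst.
  - by rewrite -[0](mulr0 m.+1`!%:R); apply: cvgMr.
apply: (@squeeze_cvgr _ _ _ _ (fun=> 0) (fun n => n.+2%:R^-1 `^ z)).
- near=> n; rewrite mulr_ge0 ?powR_ge0 ?expR_ge0//=.
  by rewrite ler_piMr ?powR_ge0// -expR0 ler_expR oppr_le0 invr_ge0.
- exact: cvg_cst.
- have := powR_cvg0 z0 => /cvg_at_rightP; apply; split.
Unshelve. all: by end_near. Qed.

Lemma nested_itv_bigcup (R : realType) :
  \bigcup_n `[n.+2%:R^-1 : R, n.+2%:R]%classic = `]0%R, +oo[%classic.
Proof.
apply/seteqP; split => [x [n _]|x] /=.
  rewrite !in_itv/= andbT => /andP[h _]; apply: lt_le_trans h.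
  by rewrite invr_gt0.
rewrite in_itv/= andbT => x0.
exists (Num.bound (x + x^-1)) => //=.
have xV0 : 0 < x^-1 by rewrite invr_gt0.
have := archi_boundP (addr_ge0 (ltW x0) (ltW xV0)).
set m := Num.bound _ => h.
have hm : (m%:R <= m.+2%:R :> R) by rewrite ler_nat; lia.
rewrite in_itv/=; apply/andP; split; last lra.
rewrite -[leRHS]invrK lef_pV2 ?posrE//; lra.
Qed.

Lemma is_derive_powR_expRN (R : realType) (z x : R) : 0 < x ->
  is_derive x 1 (fun y : R => y `^ z * expR (- y))
    (z * (x `^ (z - 1) * expR (- x)) - x `^ z * expR (- x)).
Proof.
move=> x0.
have d1 : is_derive x 1 (fun y : R => y `^ z) (z * x `^ (z - 1)).
  exact: is_derive1_powR.
have d2 : is_derive x 1 (fun y : R => expR (- y)) (- expR (- x)).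
  apply: is_derive_eq.
  by rewrite /GRing.scale/= mulrN1.
have := is_deriveM d1 d2.
rewrite /GRing.scale/= => d.
rewrite (_ : _ - _ = x `^ z * - expR (- x) +
  expR (- x) * (z * x `^ (z - 1))); [exact: d|ring].
Qed.

(** Integration by parts on the compact intervals [1/n, n], where the integrand is
    continuous even for z < 1, followed by monotone convergence. *)
Lemma egammaS (R : realType) (z : R) : 0 < z ->
  (egamma (z + 1) = z%:E * egamma z)%E.
Proof.
move=> z0.
pose J n := `[n.+2%:R^-1 : R, n.+2%:R]%classic.
have ndJ : nondecreasing_seq J.
  apply/nondecreasing_seqP => n; rewrite subsetEset /J => x /=.
  rewrite !in_itv/= => /andP[h1 h2]; apply/andP; split.
    by apply: le_trans h1; rewrite lef_pV2 ?posrE// ler_nat.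
  by apply: le_trans h2 _; rewrite ler_nat.
have cvgJ t : (\int[lebesgue_measure]_(x in J i) (x `^ (t - 1) * expR (- x))%:E
    @[i --> \oo] --> egamma t)%E.
  rewrite /egamma -nested_itv_bigcup.
  apply: ge0_nondecreasing_set_cvg_integral => //.
  - by move=> i; exact: measurable_itv.
  - by move=> i; exact: measurable_Egamma_density.
  - by move=> i x _; exact: egamma_density_ge0.
have lim1 := cvgJ (z + 1).
have lim2 : (z%:E * \int[lebesgue_measure]_(x in J i)
    (x `^ (z - 1) * expR (- x))%:E @[i --> \oo] --> z%:E * egamma z)%E.
  exact: (cvgeZl _ (cvgJ z)).
have lim3 : ((n.+2%:R `^ z * expR (- n.+2%:R)
    - n.+2%:R^-1 `^ z * expR (- n.+2%:R^-1))%:E : \bar R)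
    @[n --> \oo] --> 0%E.
  by apply: cvg_EFin; [exact: nearW|exact: gamma_boundary_cvg].
have lim4 := cvgeB _ lim2 lim3.
rewrite -[RHS]sube0.
have /cvg_unique := lim1; apply => //.
suff -> : (fun i => \int[lebesgue_measure]_(x in J i)
      (x `^ (z + 1 - 1) * expR (- x))%:E)%E =
    (fun n => (z%:E * \int[lebesgue_measure]_(x in J n)
      (x `^ (z - 1) * expR (- x))%:E - (n.+2%:R `^ z * expR (- n.+2%:R)
    - n.+2%:R^-1 `^ z * expR (- n.+2%:R^-1))%:E)%E).
  by apply: lim4; rewrite fin_num_adde_defl.
apply/funext => n; rewrite addrK.
have lt_itv : (n.+2%:R^-1 : R) < n.+2%:R.
  by rewrite (@lt_trans _ _ 1)// ?invf_lt1// ltr1n.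
have cden t : {within `[n.+2%:R^-1 : R, n.+2%:R],
    continuous (fun x : R => x `^ t * expR (- x))}.
  apply: derivable_within_continuous => x xJ.
  apply: ex_derive; apply: is_derive_powR_expRN.
  by move: xJ; rewrite in_itv/= => /andP[h _]; apply: lt_le_trans h.
have iden t : lebesgue_measure.-integrable (J n)
    (EFin \o (fun x : R => x `^ t * expR (- x))).
  apply: continuous_compact_integrable; last exact: cden.
  exact: segment_compact.
have cont (x : R) : 0 < x -> {for x, continuous (fun x : R => x `^ z * expR (- x))}.
  move=> x0; apply/differentiable_continuous/derivable1_diffP.
  by apply: ex_derive; apply: is_derive_powR_expRN.
have := @continuous_FTC2 R
  (fun x => z * (x `^ (z - 1) * expR (- x)) - x `^ z * expR (- x))
  (fun x => x `^ z * expR (- x)) n.+2%:R^-1 n.+2%:R lt_itv.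
move=> FTC; rewrite EFinB -FTC; first last.
- move=> x; rewrite in_itv/= => /andP[h _].
  rewrite derive1E; apply: (@derive_val _ _ _ _ _ _ _ (is_derive_powR_expRN _ _)).
  exact: lt_trans h.
- split.
  + move=> x; rewrite in_itv/= => /andP[h _].
    by apply: ex_derive; apply: is_derive_powR_expRN; exact: lt_trans h.
  + by apply: cvg_at_right_filter; exact: cont.
  + by apply: cvg_at_left_filter; apply: cont; exact: lt_trans lt_itv.
- apply: derivable_within_continuous => x xJ.
  have x0 : 0 < x.
    by move: xJ; rewrite in_itv/= => /andP[h _]; apply: lt_le_trans h.
  have d1 := is_derive_powR_expRN (z - 1) x0.
  have d2 := is_derive_powR_expRN z x0.
  by apply: derivableB; [apply: derivableM => //|];
    apply: ex_derive.
have izden : lebesgue_measure.-integrable (J n)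
    (fun x => (z * (x `^ (z - 1) * expR (- x)))%:E).
  pose h := EFin \o (fun x : R => x `^ (z - 1) * expR (- x)).
  have := @integrableZl _ _ _ lebesgue_measure (J n) _ z h (iden (z - 1)).
  by apply; exact: measurable_itv.
under [X in (_ = _ - X)%E]eq_integral do rewrite EFinB.
rewrite integralB_EFin//.
under [X in (_ = _ - (X - _))%E]eq_integral do rewrite EFinM.
rewrite (@integralZl _ _ _ _ _ _ (EFin \o _))//.
  rewrite fin_num_oppeB ?integrable_fin_num//; last exact: iden.
  rewrite addeA subee ?add0e// fin_numM// integrable_fin_num//.
  exact: measurable_itv.
exact: iden.
Qed.

Lemma integral_expRN (R : realType) (a : R) :
  (\int[lebesgue_measure]_(x in `[a, +oo[) (expR (- x))%:E = (expR (- a))%:E)%E.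
Proof.
have d (x : R) : is_derive x 1 (fun y : R => - expR (- y)) (expR (- x)).
  apply: is_derive_eq.
  by rewrite /GRing.scale/= mulrN1 opprK.
have c (x : R) : {for x, continuous (fun y : R => expR (- y))}.
  by apply: continuous_comp; [exact: opp_continuous|exact: continuous_expR].
rewrite (@ge0_continuous_FTC2y R (fun x => expR (- x))
  (fun x => - expR (- x)) a 0).
- by rewrite sub0e -EFinN opprK.
- by move=> x _; exact: expR_ge0.
- by apply: continuous_subspaceT => x; exact: c.
- by rewrite -oppr0; apply: cvgN; exact: cvgr_expR.
- by move=> x _; apply: ex_derive.
- by apply: cvg_at_right_filter; apply: cvgN; exact: c.
- by move=> x _; rewrite derive1E; exact: derive_val.
Qed.

(** For z >= 1 the integrand dominates exp(-x) on [1, +oo); the functional equation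
    reduces the other values of z to this case. *)
Lemma egamma_gt0 (R : realType) (z : R) : 0 < z -> (0 < egamma z)%E.
Proof.
wlog : z / 1 <= z.
  move=> wl z0; have := wl (z + 1).
  rewrite lerDr egammaS// => /(_ (ltW z0) (addr_gt0 z0 ltr01)).
  by rewrite pmule_rgt0// lte_fin.
move=> z1 z0.
apply: (@lt_le_trans _ _ (expR (- 1) : R)%:E); first by rewrite lte_fin expR_gt0.
rewrite -integral_expRN.
apply: (@le_trans _ _ (\int[lebesgue_measure]_(x in `[1%R, +oo[)
    (x `^ (z - 1) * expR (- x))%:E)%E).
  apply: ge0_le_integral.
  - exact: measurable_itv.
  - by move=> x _; rewrite lee_fin expR_ge0.
  - apply/measurable_EFinP; apply: (@measurable_funS _ _ _ _ setT) => //.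
    by apply: measurableT_comp => //; exact: measurableT_comp.
  - exact: measurable_Egamma_density.
  - move=> x; rewrite /= in_itv/= andbT => x1.
    rewrite lee_fin ler_peMl ?expR_ge0//.
    by rewrite -[leLHS](powRr0 x) ler_powR// subr_ge0.
apply: ge0_subset_integral.
- exact: measurable_itv.
- exact: measurable_itv.
- exact: measurable_Egamma_density.
- by move=> x _; exact: egamma_density_ge0.
- by move=> x; rewrite /= !in_itv/= !andbT; apply: lt_le_trans.
Qed.

Lemma egamma1 (R : realType) : egamma (1 : R) = 1%E.
Proof.
rewrite egammaE; under eq_integral do rewrite subrr powRr0 mul1r.
by rewrite integral_expRN oppr0 expR0.
Qed.

(** The functional equation gives finiteness at the positive integers, starting from
    1.  For z >= 1, x^(z-1) lies below 1 + x^m as soon as m >= z - 1; for smaller z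
    the functional equation is used once more. *)
Lemma egamma_fin_num (R : realType) (z : R) : 0 < z -> egamma z \is a fin_num.
Proof.
wlog : z / 1 <= z.
  move=> wl z0; have := wl (z + 1).
  rewrite lerDr egammaS// => /(_ (ltW z0) (addr_gt0 z0 ltr01)).
  have := egamma_gt0 z0.
  by case: (egamma z) => // ; rewrite gt0_muley ?lte_fin.
move=> z1 z0.
have fin_nat n : egamma (n.+1%:R : R) \is a fin_num.
  elim: n => [|n IH]; first by rewrite egamma1.
  by rewrite -natr1 egammaS// fin_numM.
pose m := Num.bound z.
have zm : z - 1 <= m%:R by have := archi_boundP (ltW z0); rewrite -/m; lra.
rewrite ge0_fin_numE ?(ltW (egamma_gt0 z0))//.
apply: (@le_lt_trans _ _ (egamma 1 + egamma (m.+1%:R))%E); last first.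
  by rewrite ltey_eq egamma1 fin_numD (fin_nat m).
rewrite /egamma -ge0_integralD; last 5 first.
- exact: measurable_itv.
- by move=> x _; exact: egamma_density_ge0.
- exact: measurable_Egamma_density.
- by move=> x _; exact: egamma_density_ge0.
- exact: measurable_Egamma_density.
apply: ge0_le_integral.
- exact: measurable_itv.
- by move=> x _; exact: egamma_density_ge0.
- exact: measurable_Egamma_density.
- by apply: emeasurable_funD; exact: measurable_Egamma_density.
move=> x; rewrite /= in_itv/= andbT => x0.
rewrite -EFinD lee_fin -mulrDl ler_wpM2r ?expR_ge0//.
rewrite subrr powRr0 -natr1 addrK.
have [x1|x1] := leP 1 x.
  by rewrite (le_trans (ler_powR x1 zm))// lerDr.
rewrite (@le_trans _ _ 1) ?lerDl ?powR_ge0//.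
by rewrite -[leRHS](powRr0 x) ger_powR ?subr_ge0// x0 ltW.
Qed.

Lemma GammaE (R : realType) (z : R) : Gamma z = fine (egamma z).
Proof. by rewrite egammaE. Qed.

Lemma Gamma_gt0 (R : realType) (z : R) : 0 < z -> 0 < Gamma z.
Proof.
by move=> z0; rewrite GammaE fine_gt0// egamma_gt0// -ge0_fin_numE
  ?egamma_fin_num// ltW// egamma_gt0.
Qed.

Lemma GammaS (R : realType) (z : R) : 0 < z -> Gamma (z + 1) = z * Gamma z.
Proof. by move=> z0; rewrite !GammaE egammaS// fineM// egamma_fin_num. Qed.

Lemma integrable_gamma_density (R : realType) (z : R) : 0 < z ->
  lebesgue_measure.-integrable `]0%R, +oo[
    (fun x => (x `^ (z - 1) * expR (- x))%:E).
Proof.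
move=> z0; apply/integrableP; split; first exact: measurable_Egamma_density.
under eq_integral do rewrite gee0_abs ?egamma_density_ge0//.
by rewrite -ge0_fin_numE ?egamma_fin_num// ltW// egamma_gt0.
Qed.

(** Gamma sealed against unfolding: unification of two different Gamma values would
    otherwise try to compare the integrals. *)
HB.lock Definition Gam (R : realType) (z : R) : R := Gamma z.

Lemma Gam_gt0 (R : realType) (z : R) : 0 < z -> 0 < Gam z.
Proof. by rewrite Gam.unlock; exact: Gamma_gt0. Qed.

Lemma GamS (R : realType) (z : R) : 0 < z -> Gam (z + 1) = z * Gam z.
Proof. by rewrite Gam.unlock; exact: GammaS. Qed.

(** * Moments of the Laguerre weight *)

Lemma Rintegral_gamma_density (R : realType) (z : R) :
  \int[lebesgue_measure]_(x in `]0, +oo[) (x `^ (z - 1) * expR (- x)) = Gamma z.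
Proof. by rewrite GammaE. Qed.

(** Integrability is carried along because additivity of the integral requires it. *)
Lemma Rintegral_gamma_sum (R : realType) (g : R) (c : nat -> R) (n : nat) :
  -1 < g ->
  lebesgue_measure.-integrable `]0%R, +oo[ (EFin \o (fun x =>
    \sum_(i < n) c i * (x `^ (g + i%:R + 1 - 1) * expR (- x)))) /\
  \int[lebesgue_measure]_(x in `]0, +oo[)
    (\sum_(i < n) c i * (x `^ (g + i%:R + 1 - 1) * expR (- x))) =
  \sum_(i < n) c i * Gamma (g + i%:R + 1).
Proof.
move=> g1.
have gi i : 0 < g + i%:R + 1 by have := ler0n R i; lra.
elim: n => [|n [IHi IH]].
  split; last first.
    under eq_Rintegral do rewrite big_ord0.
    by rewrite big_ord0 Rintegral_cst ?mul0r//; exact: measurable_itv.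
  rewrite (_ : _ \o _ = cst 0%E); last first.
    by apply/funext => x /=; rewrite big_ord0.
  exact: integrable0.
have idn := integrable_gamma_density (gi n).
have icdn : lebesgue_measure.-integrable `]0%R, +oo[ (EFin \o (fun x =>
    c n * (x `^ (g + n%:R + 1 - 1) * expR (- x)))).
  have := @integrableZl _ _ _ lebesgue_measure `]0%R, +oo[ _ (c n) _ idn.
  by apply; exact: measurable_itv.
split.
  pose h1 (x : R) :=
    \sum_(i < n) c i * (x `^ (g + i%:R + 1 - 1) * expR (- x)).
  pose h2 (x : R) := c n * (x `^ (g + n%:R + 1 - 1) * expR (- x)).
  rewrite (_ : _ \o _ = ((EFin \o h1) \+ (EFin \o h2))%E); last first.
    by apply/funext => x; rewrite /comp big_ord_recr.
  by apply: integrableD => //; exact: measurable_itv.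
under eq_Rintegral do rewrite big_ord_recr/=.
rewrite RintegralD; [|exact: measurable_itv|exact: IHi|exact: icdn].
rewrite IH RintegralZl; [|exact: measurable_itv|exact: idn].
by rewrite big_ord_recr/= Rintegral_gamma_density.
Qed.

Lemma laguerre_ipE (R : realType) (g : R) (p q : {poly R}) : -1 < g ->
  laguerre_ip g p q = (Gam (g + 1))^-1 *
    \sum_(i < size (p * q)) (p * q)`_i * Gam (g + i%:R + 1).
Proof.
move=> g1; rewrite Gam.unlock; congr (_ * _).
rewrite -(Rintegral_gamma_sum (fun i => (p * q)`_i) _ g1).2.
rewrite /Rintegral -integral_itv_obnd_cbnd; last first.
  apply/measurable_EFinP; apply: (@measurable_funS _ _ _ _ setT) => //.
  apply: measurable_funM; last first.
    by apply: measurableT_comp => //; exact: measurableT_comp.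
  apply: measurable_funM; last exact: measurable_powR.
  by apply: measurable_funM; apply: continuous_measurable_fun => x;
    exact: continuous_horner.
congr fine; apply: eq_integral => x; rewrite inE/= in_itv/= andbT => x0.
congr EFin; rewrite -hornerM horner_coef !mulr_suml; apply: eq_bigr => i _.
have -> : x `^ (g + i%:R + 1 - 1) = x `^ g * x ^+ i.
  by rewrite addrK powRD ?(gt_eqF x0) ?implybT// powR_mulrn// ltW.
ring.
Qed.

(** * Laguerre polynomials as finite differences *)

(** The functional p |-> laguerre_ip g p 1 in coefficients, where linearity is
    immediate. *)
Definition laguerre_moment (R : realType) (g : R) (p : {poly R}) : R :=
  \sum_(i < size p) p`_i * (Gam (g + i%:R + 1) / Gam (g + 1)).

Lemma laguerre_ip_moment (R : realType) (g : R) (p q : {poly R}) : -1 < g ->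
  laguerre_ip g p q = laguerre_moment g (p * q).
Proof.
move=> g1; rewrite laguerre_ipE// mulr_sumr; apply: eq_bigr => i _.
by rewrite mulrC mulrA.
Qed.

Lemma laguerre_moment_widen (R : realType) (g : R) (p : {poly R}) (n : nat) :
  (size p <= n)%N -> laguerre_moment g p =
  \sum_(i < n) p`_i * (Gam (g + i%:R + 1) / Gam (g + 1)).
Proof.
move=> pn; pose F i := p`_i * (Gam (g + i%:R + 1) / Gam (g + 1)).
rewrite /laguerre_moment (big_ord_widen n F pn) big_mkcond/= /F.
apply: eq_bigr => i _; case: ltnP => // h.
by rewrite nth_default// mul0r.
Qed.

Lemma laguerre_momentD (R : realType) (g : R) (p q : {poly R}) :
  laguerre_moment g (p + q) = laguerre_moment g p + laguerre_moment g q.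
Proof.
rewrite (laguerre_moment_widen g (size_polyD p q)).
rewrite (laguerre_moment_widen g (leq_maxl (size p) (size q))).
rewrite (laguerre_moment_widen g (leq_maxr (size p) (size q))).
by rewrite -big_split; apply: eq_bigr => i _; rewrite coefD mulrDl.
Qed.

Lemma laguerre_momentZ (R : realType) (g c : R) (p : {poly R}) :
  laguerre_moment g (c *: p) = c * laguerre_moment g p.
Proof.
rewrite (laguerre_moment_widen g (size_scale_leq c p)) mulr_sumr.
by apply: eq_bigr => i _; rewrite coefZ -mulrA.
Qed.

Lemma laguerre_moment0 (R : realType) (g : R) : laguerre_moment g 0 = 0.
Proof. by have := laguerre_momentZ g 0 0; rewrite scale0r mul0r. Qed.

Lemma laguerre_moment_sum (R : realType) (g : R) (I : Type) (r : seq I)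
    (F : I -> {poly R}) :
  laguerre_moment g (\sum_(i <- r) F i) = \sum_(i <- r) laguerre_moment g (F i).
Proof.
elim: r => [|i r IH]; first by rewrite !big_nil laguerre_moment0.
by rewrite !big_cons laguerre_momentD IH.
Qed.

Lemma laguerre_ip_ge0 (R : realType) (g : R) (p : {poly R}) : -1 < g ->
  0 <= laguerre_ip g p p.
Proof.
move=> g1; rewrite /laguerre_ip mulr_ge0// ?invr_ge0.
  by rewrite ltW// Gamma_gt0//; lra.
apply: Rintegral_ge0 => x _.
by rewrite mulr_ge0 ?expR_ge0// mulr_ge0 ?powR_ge0// -expr2 sqr_ge0.
Qed.

Lemma alternating_binomS (R : pzRingType) (a : nat -> R) (m : nat) :
  \sum_(i < m.+2) (-1) ^+ i * 'C(m.+1, i)%:R * a i =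
  \sum_(i < m.+1) (-1) ^+ i * 'C(m, i)%:R * (a i - a i.+1).
Proof.
under [RHS]eq_bigr do rewrite mulrBr.
rewrite sumrB big_ord_recl/= bin0.
under eq_bigr => i _ do rewrite /bump/= add1n binS natrD mulrDr mulrDl.
rewrite big_split/= addrA; congr (_ + _); last first.
  by rewrite -sumrN; apply: eq_bigr => i _; rewrite exprS mulN1r !mulNr.
transitivity (\sum_(i < m.+2) (-1) ^+ i * 'C(m, i)%:R * a i).
  by rewrite [RHS]big_ord_recl/= bin0.
by rewrite [LHS]big_ord_recr/= bin_small// mulr0 mul0r addr0.
Qed.

Lemma gbinomS (R : realType) (t : R) (m : nat) :
  gbinom t m.+1 * m.+1%:R = gbinom t m * (t - m%:R).
Proof.
rewrite /gbinom big_ord_recr/= factS natrM.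
field.
by rewrite nat1r !pnatr_eq0 -lt0n fact_gt0.
Qed.

(** A difference step turns a quotient of Gamma values into a multiple of another one:
    G(x+t)/G(x) - G(x+1+t)/G(x+1) = - t G(x+t)/G(x+1).  This one identity
    yields the orthogonality and the norms of the Laguerre polynomials, their mixed
    moments, and the duality of the limit forms. *)
Lemma gamma_ratio_diff (R : realType) (m : nat) (x t : R) : 0 < x -> 0 < x + t ->
  \sum_(i < m.+1) (-1) ^+ i * 'C(m, i)%:R * (Gam (x + i%:R + t) / Gam (x + i%:R)) =
  (-1) ^+ m * m`!%:R * gbinom t m * (Gam (x + t) / Gam (x + m%:R)).
Proof.
elim: m x => [|m IH] x x0 xt0.
  by rewrite big_ord1 /gbinom big_ord0 bin0 expr0 addr0 fact0 divr1 !mul1r.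
rewrite (alternating_binomS
  (fun i => Gam (x + i%:R + t) / Gam (x + i%:R))).
under eq_bigr do rewrite mulrBr.
rewrite sumrB (IH _ x0 xt0).
under eq_bigr => i _ do rewrite -natr1 (addrC i%:R) addrA.
rewrite IH; [|lra|lra].
rewrite (_ : x + 1 + t = x + t + 1); last by ring.
rewrite (_ : x + 1 + m%:R = x + m%:R + 1); last by ring.
rewrite (_ : x + m.+1%:R = x + m%:R + 1); last by rewrite -natr1; ring.
have xm0 : 0 < x + m%:R by have := ler0n R m; lra.
rewrite !GamS// factS natrM.
rewrite (_ : _ * gbinom t m.+1 =
  (-1) ^+ m.+1 * m`!%:R * (gbinom t m.+1 * m.+1%:R)); last by ring.
rewrite gbinomS exprS.
have /lt0r_neq0 := Gam_gt0 xm0; have /lt0r_neq0 := xm0.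
move: (Gam (x + t)) (Gam (x + m%:R)) (gbinom t m) (m`!%:R) ((-1) ^+ m).
by move=> A B C D E nB nx; field; rewrite nB nx.
Qed.

Definition laguerre_poly (R : realType) (g : R) (m : nat) : {poly R} :=
  \poly_(i < m.+1) ((-1) ^+ i * Gam (g + m%:R + 1) /
    (i`!%:R * (m - i)`!%:R * Gam (g + i%:R + 1))).

(** The integral of the Laguerre polynomial of parameter g against x^(g+t) e^(-x). *)
Lemma laguerre_poly_transform (R : realType) (g t : R) (m : nat) :
  0 < g + 1 -> 0 < g + 1 + t ->
  \sum_(i < m.+1) (laguerre_poly g m)`_i * Gam (g + t + i%:R + 1) =
  (-1) ^+ m * gbinom t m * Gam (g + t + 1).
Proof.
move=> g0 gt0.
have gm0 (i : nat) : 0 < g + i%:R + 1 by have := ler0n R i; lra.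
have -> : (-1) ^+ m * gbinom t m * Gam (g + t + 1) =
    Gam (g + m%:R + 1) / m`!%:R * ((-1) ^+ m * m`!%:R * gbinom t m *
      (Gam (g + 1 + t) / Gam (g + 1 + m%:R))).
  have -> : g + 1 + m%:R = g + m%:R + 1 by ring.
  have -> : g + 1 + t = g + t + 1 by ring.
  have /lt0r_neq0 := Gam_gt0 (gm0 m).
  have : m`!%:R != 0 :> R by rewrite pnatr_eq0 -lt0n fact_gt0.
  move: (Gam (g + t + 1)) (Gam (g + m%:R + 1)) (gbinom t m) (m`!%:R).
  by move: ((-1) ^+ m) => A B C D E nE nC; field; rewrite nE nC.
rewrite -gamma_ratio_diff// mulr_sumr; apply: eq_bigr => i _.
rewrite coef_poly ltn_ord.
rewrite (_ : g + 1 + i%:R + t = g + t + i%:R + 1); last by ring.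
rewrite (_ : g + 1 + i%:R = g + i%:R + 1); last by ring.
have im : (i <= m)%N by rewrite -ltnS.
rewrite -(bin_fact im) !natrM.
have : 'C(m, i)%:R != 0 :> R by rewrite pnatr_eq0 -lt0n bin_gt0.
have : i`!%:R != 0 :> R by rewrite pnatr_eq0 -lt0n fact_gt0.
have : (m - i)`!%:R != 0 :> R by rewrite pnatr_eq0 -lt0n fact_gt0.
have /lt0r_neq0 := Gam_gt0 (gm0 i).
move: (Gam (g + t + i%:R + 1)) (Gam (g + m%:R + 1)) (Gam (g + i%:R + 1)).
move: ((-1) ^+ i) ('C(m, i)%:R) (i`!%:R) ((m - i)`!%:R).
by move=> A B C D E F H nH nD nC nB; field; rewrite nH nD nC nB.
Qed.

Lemma size_laguerre_poly (R : realType) (g : R) (m : nat) : -1 < g ->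
  size (laguerre_poly g m) = m.+1.
Proof.
move=> g1; apply: size_poly_eq.
have gm : 0 < g + m%:R + 1 by have := ler0n R m; lra.
rewrite subnn fact0 mulr1 mulf_neq0 ?mulf_eq0 ?signr_eq0 ?gt_eqF ?Gam_gt0//.
by rewrite invr_gt0 mulr_gt0 ?Gam_gt0// ltr0n fact_gt0.
Qed.

Lemma lead_coef_laguerre_poly (R : realType) (g : R) (m : nat) : -1 < g ->
  lead_coef (laguerre_poly g m) = (-1) ^+ m / m`!%:R.
Proof.
move=> g1; rewrite /lead_coef size_laguerre_poly//= coef_poly ltnSn subnn fact0.
have gm : 0 < g + m%:R + 1 by have := ler0n R m; lra.
have /lt0r_neq0 := Gam_gt0 gm.
have : m`!%:R != 0 :> R by rewrite pnatr_eq0 -lt0n fact_gt0.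
move: (Gam _) (m`!%:R) ((-1) ^+ m) => A B C nB nA; field; by rewrite nB nA.
Qed.

(** The parameter g of the polynomial and the parameter a of the weight are unrelated
    here: t measures the discrepancy, and may be negative. *)
Lemma laguerre_moment_Xn_laguerre (R : realType) (a g t : R) (s m : nat) :
  -1 < a -> -1 < g -> 0 < g + 1 + t -> a + s%:R = g + t ->
  laguerre_moment a ('X^s * laguerre_poly g m) =
  (-1) ^+ m * gbinom t m * (Gam (g + t + 1) / Gam (a + 1)).
Proof.
move=> a1 g1 gt1 E.
have sz : (size ('X^s * laguerre_poly g m)%R <= s + m.+1)%N.
  by rewrite -(size_laguerre_poly m g1) (leq_trans (size_polyMleq _ _))//
    size_polyXn.
rewrite (laguerre_moment_widen a sz) big_split_ord/= big1 ?add0r; last first.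
  by move=> i _; rewrite coefXnM ltn_ord mul0r.
rewrite mulrA -laguerre_poly_transform//; last lra.
rewrite mulr_suml; apply: eq_bigr => i _.
rewrite coefXnM ltnNge leq_addr/= addKn mulrA; congr (_ * Gam _ / _).
by rewrite natrD -E; ring.
Qed.

Lemma laguerre_ip_Xn (R : realType) (g : R) (m k : nat) : -1 < g ->
  laguerre_ip g (laguerre_poly g m) 'X^k =
  (-1) ^+ m * gbinom k%:R m * (Gam (g + k%:R + 1) / Gam (g + 1)).
Proof.
move=> g1; rewrite laguerre_ip_moment// mulrC.
by apply: laguerre_moment_Xn_laguerre => //; have := ler0n R k; lra.
Qed.

Lemma gbinom_small (R : realType) (k m : nat) : (k < m)%N -> gbinom (k%:R : R) m = 0.
Proof.
by move=> km; rewrite /gbinom (bigD1 (Ordinal km))//= subrr !mul0r.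
Qed.

Lemma gbinom_nat (R : realType) (k m : nat) : (m <= k)%N ->
  gbinom (k%:R : R) m = 'C(k, m)%:R.
Proof.
move=> mk.
have f0 n : n`!%:R != 0 :> R by rewrite pnatr_eq0 -lt0n fact_gt0.
apply: (mulIf (f0 m)); rewrite divfK// -natrM bin_ffact ffact_prod natr_prod.
by apply: eq_bigr => i _; rewrite natrB// (leq_trans (ltnW (ltn_ord i))).
Qed.

Lemma laguerre_ip_sumr (R : realType) (g : R) (p q : {poly R}) : -1 < g ->
  laguerre_ip g p q = \sum_(i < size q) q`_i * laguerre_ip g p 'X^i.
Proof.
move=> g1; rewrite -[q in LHS]coefK poly_def laguerre_ip_moment// mulr_sumr.
rewrite laguerre_moment_sum; apply: eq_bigr => i _.
by rewrite laguerre_ip_moment// -scalerAr laguerre_momentZ.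
Qed.

Lemma laguerre_ipDl (R : realType) (g : R) (p1 p2 q : {poly R}) : -1 < g ->
  laguerre_ip g (p1 + p2) q = laguerre_ip g p1 q + laguerre_ip g p2 q.
Proof.
by move=> g1; rewrite !laguerre_ip_moment// mulrDl laguerre_momentD.
Qed.

Lemma laguerre_ipZl (R : realType) (g c : R) (p q : {poly R}) : -1 < g ->
  laguerre_ip g (c *: p) q = c * laguerre_ip g p q.
Proof.
by move=> g1; rewrite !laguerre_ip_moment// -scalerAl laguerre_momentZ.
Qed.

Lemma laguerre_ipC (R : realType) (g : R) (p q : {poly R}) :
  laguerre_ip g p q = laguerre_ip g q p.
Proof.
rewrite /laguerre_ip; congr (_ * _); apply: eq_Rintegral => x _.
by rewrite [p.[x] * _]mulrC.
Qed.

Lemma laguerre_poly_orth (R : realType) (g : R) (m : nat) (q : {poly R}) :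
  -1 < g -> (size q <= m)%N -> laguerre_ip g (laguerre_poly g m) q = 0.
Proof.
move=> g1 qm; rewrite laguerre_ip_sumr// big1// => i _.
by rewrite laguerre_ip_Xn// gbinom_small ?mulr0 ?mul0r ?mulr0//
  (leq_trans (ltn_ord i)).
Qed.

Lemma laguerre_ip_lead (R : realType) (g : R) (m : nat) (q : {poly R}) :
  -1 < g -> size q = m.+1 -> laguerre_ip g (laguerre_poly g m) q =
  (-1) ^+ m * lead_coef q * (Gam (g + m%:R + 1) / Gam (g + 1)).
Proof.
move=> g1 qm; rewrite laguerre_ip_sumr// qm big_ord_recr/= big1 ?add0r.
  by rewrite laguerre_ip_Xn// gbinom_nat// binn /lead_coef qm/=; ring.
by move=> i _; rewrite laguerre_ip_Xn// gbinom_small ?mulr0 ?mul0r ?mulr0.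
Qed.

Lemma laguerre_poly_norm2 (R : realType) (g : R) (m : nat) : -1 < g ->
  laguerre_ip g (laguerre_poly g m) (laguerre_poly g m) =
  Gam (g + m%:R + 1) / (m`!%:R * Gam (g + 1)).
Proof.
move=> g1; rewrite laguerre_ip_lead ?size_laguerre_poly//.
by rewrite lead_coef_laguerre_poly// [(-1) ^+ m * _]mulrA -expr2 sqrr_sign
  invfM; ring.
Qed.

Lemma gbinom_laguerre (R : realType) (g : R) (m : nat) : -1 < g ->
  gbinom (m%:R + g) m = Gam (g + m%:R + 1) / (m`!%:R * Gam (g + 1)).
Proof.
move=> g1.
suff -> : Gam (g + m%:R + 1) = (\prod_(i < m) (m%:R + g - i%:R)) * Gam (g + 1).
  have : m`!%:R != 0 :> R by rewrite pnatr_eq0 -lt0n fact_gt0.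
  have /lt0r_neq0 : 0 < Gam (g + 1) by apply: Gam_gt0; lra.
  rewrite /gbinom; move: (Gam _) (\prod_(_ < _) _) (m`!%:R) => A B C nA nC.
  by field; rewrite nA nC.
elim: m => [|m IH]; first by rewrite big_ord0 mul1r addr0.
rewrite big_ord_recl/= subr0.
rewrite (eq_bigr (fun i : 'I_m => m%:R + g - i%:R)); last first.
  by move=> i _; rewrite /bump/= add1n -!natr1; ring.
rewrite -mulrA -IH -natr1 (_ : m%:R + 1 + g = g + m%:R + 1); last by ring.
rewrite -GamS//; last by have := ler0n R m; lra.
by rewrite addrA.
Qed.

(** The difference between p and the multiple of the explicit polynomial with the same
    leading coefficient is orthogonal to all polynomials of smaller degree, in
    particular to the Laguerre polynomial of its own degree, so it is 0.  The values
    at 0 then fix the multiple. *)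
Lemma is_laguerre_uniq (R : realType) (g : R) (m : nat) (p : {poly R}) :
  -1 < g -> is_laguerre g m p -> p = laguerre_poly g m.
Proof.
move=> g1 [[sp orth] p0].
pose c := lead_coef p / lead_coef (laguerre_poly g m).
have l0 : lead_coef (laguerre_poly g m) != 0.
  by rewrite lead_coef_eq0 -size_poly_eq0 size_laguerre_poly.
have E : p = c *: laguerre_poly g m.
  apply/eqP; rewrite -subr_eq0 -scaleNr; set r := (X in X == 0).
  have rorth (q : {poly R}) : (size q <= m)%N -> laguerre_ip g r q = 0.
    move=> qm; rewrite /r laguerre_ipDl// laguerre_ipZl// orth//.
    by rewrite laguerre_poly_orth// mulr0 addr0.
  have sr : (size r <= m)%N.
    apply/leq_sizeP => j; rewrite leq_eqVlt => /predU1P[<-|mj].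
      rewrite coefD coefZ mulNr.
      have -> : p`_m = lead_coef p by rewrite /lead_coef sp.
      have -> : (laguerre_poly g m)`_m = lead_coef (laguerre_poly g m).
        by rewrite /lead_coef size_laguerre_poly.
      by rewrite /c divfK// subrr.
    rewrite coefD coefZ !nth_default ?mulr0 ?addr0// ?sp//.
    by rewrite size_laguerre_poly.
  apply/negPn/negP => r0.
  have sr1 : size r = (size r).-1.+1 by rewrite prednK// size_poly_gt0.
  have := rorth (laguerre_poly g (size r).-1).
  rewrite size_laguerre_poly// -sr1 => /(_ sr).
  rewrite laguerre_ipC laguerre_ip_lead// => /eqP.
  rewrite !mulf_eq0 signr_eq0 lead_coef_eq0 (negPf r0) invr_eq0/=.
  by rewrite !gt_eqF// Gam_gt0//; have := ler0n R (size r).-1; lra.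
move: p0; rewrite E hornerZ horner_coef0 coef_poly/=.
rewrite gbinom_laguerre// fact0 subn0 addr0 expr0 !mul1r.
set G := _ / _ => /eqP; rewrite -[X in _ == X]mul1r.
have G0 : G != 0.
  rewrite gt_eqF// divr_gt0 ?mulr_gt0 ?Gam_gt0 ?ltr0n ?fact_gt0//.
    by have := ler0n R m; lra.
  by lra.
by rewrite (inj_eq (mulIf G0)) => /eqP ->; rewrite scale1r.
Qed.

(** If p had norm 0, the squared norm of l + c p, with l the Laguerre polynomial of
    the degree of p, would be a nonconstant affine function of c, yet nonnegative. *)
Lemma laguerre_ip_gt0 (R : realType) (g : R) (p : {poly R}) :
  -1 < g -> p != 0 -> 0 < laguerre_ip g p p.
Proof.
move=> g1 p0.
have sp : size p = (size p).-1.+1 by rewrite prednK// size_poly_gt0.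
set m := (size p).-1 in sp.
rewrite lt_neqAle laguerre_ip_ge0// andbT eq_sym; apply/negP => /eqP pp0.
have lp0 : laguerre_ip g (laguerre_poly g m) p != 0.
  rewrite laguerre_ip_lead// !mulf_neq0 ?signr_eq0 ?lead_coef_eq0//.
    by rewrite gt_eqF// Gam_gt0//; have := ler0n R m; lra.
  by rewrite invr_eq0 gt_eqF// Gam_gt0//; lra.
set x := laguerre_ip g (laguerre_poly g m) p in lp0.
pose y := laguerre_ip g (laguerre_poly g m) (laguerre_poly g m).
have y0 : 0 < y.
  rewrite /y laguerre_poly_norm2// divr_gt0 ?mulr_gt0 ?Gam_gt0 ?ltr0n ?fact_gt0//.
    by have := ler0n R m; lra.
  by lra.
have := laguerre_ip_ge0 (laguerre_poly g m + (- y / x) *: p) g1.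
(* The coefficient of p is chosen to make the squared norm equal to -y. *)
rewrite laguerre_ipDl// [X in X + _]laguerre_ipC laguerre_ipDl// -/y.
rewrite laguerre_ipZl// [laguerre_ip g p (laguerre_poly g m)]laguerre_ipC -/x.
rewrite [X in _ + X]laguerre_ipZl// [X in _ + _ * X]laguerre_ipC laguerre_ipDl//.
rewrite laguerre_ipZl// pp0 -/x mulr0 addr0.
rewrite divfK//; lra.
Qed.

(** * The limit forms and their duality *)

(** The coefficient of x^k in the j-th normalized basis function, for large n and up to
    factors depending only on n and k or only on j. *)
Definition taylor_ker (R : realType) (a : R) (k j : nat) : R :=
  (j <= k)%:R / (Gam (a + (j + k)%:R + 1) * (k - j)`!%:R).

(** The integral of the j-th normalized basis function against x^k, for large n and up
    to factors depending only on n and k or only on j. *)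
Definition moment_ker (R : realType) (a : R) (k j : nat) : R :=
  (k < j)%:R * (-1) ^+ j * Gam (a + (j + k)%:R + 1) / (j - k.+1)`!%:R.

Definition taylor_dual (R : realType) (a : R) (k j : nat) : R :=
  (j <= k)%:R / (Gam (a + (j + k)%:R + 2) * (k - j)`!%:R).

Definition moment_dual (R : realType) (a : R) (k j : nat) : R :=
  (k <= j)%:R * (-1) ^+ j * Gam (a + (j + k)%:R + 1) / (j - k)`!%:R.

Lemma fact_neq0R (R : realType) (n : nat) : n`!%:R != 0 :> R.
Proof. by rewrite pnatr_eq0 -lt0n fact_gt0. Qed.

(** The two-parameter family in u and v contains both substitutions needed later:
    (0, 1) for partial sums, and (1, k0) for the antiderivative of f x^(a + k0). *)
Lemma taylor_ker_step (R : realType) (a u v : R) (k j : nat) : -1 < a ->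
  (u * (a + 1 + j%:R) + v) * taylor_ker a k j
    + (u * j%:R - v) * taylor_ker a k j.+1 =
  (u * (k%:R + a + 1) + v) * ((a + 1 + 2 * j%:R) * taylor_dual a k j).
Proof.
move=> a1; rewrite /taylor_ker /taylor_dual.
have g0 (n : nat) : 0 < a + n%:R + 1 by have := ler0n R n; lra.
have [jk|kj] := leqP j k; last by rewrite (leq_gtF (ltnW kj)) !mul0r !mulr0 addr0.
rewrite (_ : a + (j + k)%:R + 2 = a + (j + k)%:R + 1 + 1); last by ring.
rewrite addSn -natr1 (addrA a) (GamS (g0 (j + k)%N)).
have := lt0r_neq0 (Gam_gt0 (g0 (j + k)%N)); have := lt0r_neq0 (g0 (j + k)%N).
move: (Gam _) => G; rewrite natrD.
move: jk; rewrite leq_eqVlt => /predU1P[->|jk].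
  rewrite ltnn subnn fact0 /= => n0 nG; by field; rewrite nG n0 fact_neq0R.
rewrite jk -(subnSK jk) factS natrM => n0 nG.
have kE : k%:R = j%:R + 1 + (k - j.+1)%:R :> R.
  by rewrite natrB// -natr1; ring.
have := fact_neq0R R (k - j.+1); move: (_ `!%:R) => F nF.
have nd : (k - j.+1).+1%:R != 0 :> R by rewrite pnatr_eq0.
move: nd n0; rewrite -natr1 kE; move: ((k - j.+1)%:R) => d nd n0.
by field; rewrite nF nG nd n0.
Qed.

Lemma moment_ker_step (R : realType) (a u v : R) (k j : nat) : -1 < a ->
  (u * (a + 1 + j%:R) + v) * moment_ker a k j
    + (u * j%:R - v) * moment_ker a k j.+1 =
  (v - u * k%:R) * ((a + 1 + 2 * j%:R) * moment_dual a k j).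
Proof.
move=> a1; rewrite /moment_ker /moment_dual.
have g0 (n : nat) : 0 < a + n%:R + 1 by have := ler0n R n; lra.
rewrite ltnS; have [kj|jk] := leqP k j; last first.
  by rewrite (leq_gtF (ltnW jk)) !mul0r !mulr0 addr0.
rewrite addSn -natr1 (addrA a) (GamS (g0 (j + k)%N)) exprS.
move: (Gam _) ((-1) ^+ j) => G S; rewrite natrD subSS.
move: kj; rewrite leq_eqVlt => /predU1P[->|kj].
  by rewrite ltnn subnn fact0 /=; field; rewrite fact_neq0R.
rewrite kj -(subnSK kj) factS natrM.
have jE : j%:R = k%:R + 1 + (j - k.+1)%:R :> R.
  by rewrite natrB// -natr1; ring.
have := fact_neq0R R (j - k.+1); move: (_ `!%:R) => F nF.
have : (j - k.+1).+1%:R != 0 :> R by rewrite pnatr_eq0.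
rewrite -natr1 jE; move: ((j - k.+1)%:R) => d nd.
by field; rewrite nF nd.
Qed.

(** For i <= j only the terms i <= k <= j survive, and they form the finite difference
    of order d = j - i of a Gamma quotient with t = d - 1, which vanishes for d > 0
    since d - 1 is a natural number smaller than d. *)
Lemma dual_orthogonality (R : realType) (a : R) (n i j : nat) : -1 < a ->
  (i < n)%N -> (j < n)%N ->
  \sum_(k < n) (-1) ^+ k * taylor_dual a k i * moment_dual a k j =
  (i == j)%:R / (a + 1 + 2 * i%:R).
Proof.
move=> a1 iN jN; rewrite /taylor_dual /moment_dual.
have [ij|ji] := leqP i j; last first.
  rewrite gtn_eqF// mul0r big1// => k _.
  have [ik|] := leqP i k; last by rewrite !mul0r mulr0 mul0r.
  by rewrite (leqNgt k j) (leq_trans ji ik)/= !mul0r mulr0.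
pose d := (j - i)%N.
have jE : j = (i + d)%N by rewrite /d subnKC.
pose F k : R := (-1) ^+ k * ((i <= k)%N%:R / (Gam (a + (i + k)%:R + 2) * (k - i)`!%:R))
  * ((k <= j)%N%:R * (-1) ^+ j * Gam (a + (j + k)%:R + 1) / (j - k)`!%:R).
rewrite -[LHS]/(\sum_(k < n) F k).
transitivity (\sum_(m < d.+1) F (i + m)%N).
  rewrite -(big_mkord xpredT F) (big_cat_nat (leq0n i) (ltnW iN))/=.
  rewrite [X in X + _]big_nat big1 ?add0r; last first.
    by move=> k /= ki; rewrite /F leqNgt ki mul0r mulr0 mul0r.
  rewrite (big_cat_nat (leqW ij) jN)/= [X in _ + X]big_nat [X in _ + X]big1 ?addr0.
    rewrite -[X in \sum_(X <= _ < _) _](add0n i) big_addn subSn// big_mkord.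
    by apply: eq_bigr => m _; rewrite addnC.
  by move=> k /andP[jk _]; rewrite /F (leqNgt k j) jk !mul0r mulr0.
have E (m : 'I_d.+1) : F (i + m)%N = (-1) ^+ d / d`!%:R *
   ((-1) ^+ m * 'C(d, m)%:R * (Gam ((a + (i + i)%:R + 2) + m%:R + (d%:R - 1))
     / Gam ((a + (i + i)%:R + 2) + m%:R))).
  have md : (m <= d)%N by rewrite -ltnS.
  rewrite /F leq_addr jE leq_add2l md addKn subnDl -(bin_fact md) !natrM.
  rewrite (_ : a + (i + (i + m))%:R + 2 = a + (i + i)%:R + 2 + m%:R); last first.
    by rewrite !natrD; ring.
  rewrite (_ : a + (i + d + (i + m))%:R + 1 =
      a + (i + i)%:R + 2 + m%:R + (d%:R - 1)); last by rewrite !natrD; ring.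
  have : Gam (a + (i + i)%:R + 2 + m%:R) != 0.
    rewrite gt_eqF// Gam_gt0//.
    by have := ler0n R (i + i); have := ler0n R m; lra.
  have : 'C(d, m)%:R != 0 :> R by rewrite pnatr_eq0 -lt0n bin_gt0.
  have := fact_neq0R R m; have := fact_neq0R R (d - m).
  have : (-1) ^+ i * (-1) ^+ i = 1 :> R by rewrite -expr2 sqrr_sign.
  rewrite !exprD.
  move: (Gam _) (Gam _) (m`!%:R) ((d - m)`!%:R) ('C(d, m)%:R).
  move: ((-1) ^+ i) ((-1) ^+ d) ((-1) ^+ m) => x y z G H M D C xx nD nM nC nH.
  have xxw w : x * x * w = w by rewrite xx mul1r.
  by rewrite -[RHS]xxw /=; field; rewrite nD nM nC nH.
rewrite (eq_bigr _ (fun m _ => E m)) -mulr_sumr.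
have ge0 := ler0n R (i + i).
have d0 := ler0n R d.
rewrite gamma_ratio_diff; [|lra|lra].
rewrite jE; case: d {E F jE d0} => [|d]; last first.
  rewrite -natr1 addrK gbinom_small// -[in X in X == _](addn0 i) eqn_add2l.
  by rewrite mulr0 mul0r mulr0 mul0r.
rewrite addn0 eqxx fact0 /gbinom big_ord0 !addr0 !expr0 !divr1 !mul1r add0r.
have x0 : 0 < a + (i + i)%:R + 1 by lra.
rewrite (_ : a + (i + i)%:R + 2 - 1 = a + (i + i)%:R + 1); last by ring.
rewrite (_ : a + (i + i)%:R + 2 = a + (i + i)%:R + 1 + 1); last by ring.
rewrite (GamS x0) invfM mulrCA mulfV ?gt_eqF ?Gam_gt0// mulr1.
by congr _^-1; rewrite natrD; ring.
Qed.

Lemma dual_quadratic_form (R : realType) (a : R) (n : nat) (s : nat -> R) :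
  -1 < a ->
  \sum_(k < n) (-1) ^+ k *
    (\sum_(i < n) (a + 1 + 2 * i%:R) * s i * taylor_dual a k i) *
    (\sum_(j < n) (a + 1 + 2 * j%:R) * s j * moment_dual a k j) =
  \sum_(i < n) (a + 1 + 2 * i%:R) * s i ^+ 2.
Proof.
move=> a1.
pose e (i : nat) : R := a + 1 + 2 * i%:R.
have e0 i : e i != 0 by rewrite gt_eqF// /e; have := ler0n R i; lra.
transitivity (\sum_(k < n) \sum_(i < n) \sum_(j < n)
    (e i * s i * (e j * s j)) * ((-1) ^+ k * taylor_dual a k i * moment_dual a k j)).
  apply: eq_bigr => k _; rewrite -mulrA mulr_suml mulr_sumr.
  apply: eq_bigr => i _; rewrite !mulr_sumr; apply: eq_bigr => j _.
  by rewrite /e; ring.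
rewrite exchange_big/=; apply: eq_bigr => i _.
rewrite exchange_big/= (bigD1 i)//= -mulr_sumr dual_orthogonality// eqxx.
rewrite big1 ?addr0; last first.
  move=> j ji; rewrite -mulr_sumr dual_orthogonality//.
  have -> : (i == j :> nat) = false by rewrite eq_sym; exact: negPf ji.
  by rewrite mul0r mulr0.
by rewrite /= -/(e i); field; exact: e0.
Qed.

(** The weights a + 1 + 2i in [dual_quadratic_form] are positive. *)
Lemma dual_trivial (R : realType) (a : R) (n : nat) (s : nat -> R) : -1 < a ->
  (forall k, (k < n)%N ->
    (\sum_(i < n) (a + 1 + 2 * i%:R) * s i * taylor_dual a k i) *
    (\sum_(j < n) (a + 1 + 2 * j%:R) * s j * moment_dual a k j) = 0) ->
  forall i, (i < n)%N -> s i = 0.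
Proof.
move=> a1 yz i iN.
have := dual_quadratic_form n s a1.
rewrite big1; last by move=> k _; rewrite -mulrA yz// mulr0.
have e0 j : 0 < a + 1 + 2 * j%:R by have := ler0n R j; lra.
move=> /esym/eqP; rewrite psumr_eq0; last first.
  by move=> j _; rewrite mulr_ge0 ?sqr_ge0// ltW.
move=> /allP/(_ (Ordinal iN) (mem_index_enum _)).
by rewrite /= mulf_eq0 gt_eqF//= sqrf_eq0 => /eqP.
Qed.

Lemma summation_by_parts (R : comPzRingType) (A B f s beta : nat -> R) (n : nat) :
  beta 0 = A 0 * s 0 ->
  (forall j, beta j.+1 = A j.+1 * s j.+1 + B j * s j) ->
  \sum_(j < n.+1) f j * beta j =
  A n * f n * s n + \sum_(j < n) (A j * f j + B j * f j.+1) * s j.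
Proof.
move=> b0 bS; elim: n => [|n IH]; first by rewrite big_ord1 big_ord0 b0; ring.
by rewrite big_ord_recr IH [in RHS]big_ord_recr/= bS; ring.
Qed.

(** For A = 1 and B = -1 these are the usual partial sums of beta. *)
Lemma partial_sums (R : fieldType) (A B beta : nat -> R) :
  (forall j, A j != 0) -> exists s : nat -> R,
  beta 0 = A 0 * s 0 /\ forall j, beta j.+1 = A j.+1 * s j.+1 + B j * s j.
Proof.
move=> A0.
pose s := fix s j := if j is j'.+1 then (beta j - B j' * s j') / A j
  else beta 0 / A 0.
by exists s; split=> [|j]/=; rewrite mulrC divfK// subrK.
Qed.

Definition taylor_form (R : realType) (a : R) (n : nat) (k : nat) (beta : nat -> R) :=
  \sum_(j < n) taylor_ker a k j * beta j.

Definition moment_form (R : realType) (a : R) (n : nat) (k : nat) (beta : nat -> R) :=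
  \sum_(j < n) moment_ker a k j * beta j.

Section Core.
Variables (R : realType) (a : R) (N : nat) (beta : nat -> R).
Hypothesis a1 : -1 < a.
Hypothesis complementary : forall k, (k < N.+1)%N ->
  taylor_form a N.+2 k beta * moment_form a N.+2 k beta = 0.

Lemma forms_dual (u v : R) (s : nat -> R) (k : nat) :
  beta 0 = (u * (a + 1 + 0%:R) + v) * s 0 ->
  (forall j, beta j.+1 = (u * (a + 1 + j.+1%:R) + v) * s j.+1 + (u * j%:R - v) * s j) ->
  taylor_form a N.+2 k beta =
    (u * (a + 1 + N.+1%:R) + v) * taylor_ker a k N.+1 * s N.+1 +
    (u * (k%:R + a + 1) + v) *
      \sum_(j < N.+1) (a + 1 + 2 * j%:R) * s j * taylor_dual a k j /\
  moment_form a N.+2 k beta =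
    (u * (a + 1 + N.+1%:R) + v) * moment_ker a k N.+1 * s N.+1 +
    (v - u * k%:R) *
      \sum_(j < N.+1) (a + 1 + 2 * j%:R) * s j * moment_dual a k j.
Proof.
pose A j := u * (a + 1 + j%:R) + v; pose B (j : nat) := u * j%:R - v.
move=> b0 bS; split.
  rewrite /taylor_form (@summation_by_parts _ A B _ s)//; congr (_ + _).
  by rewrite mulr_sumr; apply: eq_bigr => j _; rewrite taylor_ker_step//; ring.
rewrite /moment_form (@summation_by_parts _ A B _ s)//; congr (_ + _).
by rewrite mulr_sumr; apply: eq_bigr => j _; rewrite moment_ker_step//; ring.
Qed.

(** The vanishing sum makes the last partial sum 0, so that the boundary terms in
    [forms_dual] disappear. *)
Lemma sum_zero_trivial : \sum_(j < N.+2) beta j = 0 ->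
  forall j, (j < N.+2)%N -> beta j = 0.
Proof.
move=> T0.
have [|s [b0 bS]] := @partial_sums _ (fun j => 0 * (a + 1 + j%:R) + 1)
  (fun j => 0 * j%:R - 1) beta.
  by move=> j; rewrite mul0r add0r oner_neq0.
have sN : s N.+1 = 0.
  have := @summation_by_parts _ (fun j => 0 * (a + 1 + j%:R) + 1)
    (fun j => 0 * j%:R - 1) (fun=> 1) s beta N.+1 b0 bS.
  under eq_bigr do rewrite mul1r.
  rewrite T0 [X in _ = _ + X]big1 => [|j _]; last by ring.
  by move=> h; rewrite [RHS]h; ring.
have s0 : forall j, (j < N.+1)%N -> s j = 0.
  apply: (dual_trivial a1) => k kN.
  have := complementary kN; have [-> ->] := forms_dual k b0 bS.
  by rewrite sN !mulr0 !mul0r !add0r subr0 !mul1r.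
have s00 j : (j < N.+2)%N -> s j = 0.
  by rewrite ltnS leq_eqVlt => /predU1P[->//|/s0].
case=> [_|j jN]; first by rewrite b0 s00// mulr0.
by rewrite bS !s00 ?mulr0 ?addr0// ltnW.
Qed.

(** With (u, v) = (1, k0) the factor v - u k vanishes exactly at k = k0, so the moment
    form at k0 reduces to its boundary term; its vanishing plays the part of the
    vanishing sum in [sum_zero_trivial]. *)
Lemma double_zero_trivial (k0 : nat) : (k0 < N.+1)%N ->
  (forall j, (j <= k0)%N -> beta j = 0) -> moment_form a N.+2 k0 beta = 0 ->
  forall j, (j < N.+2)%N -> beta j = 0.
Proof.
move=> k0N bk Ck.
have A0 j : 1 * (a + 1 + j%:R) + k0%:R != 0.
  by rewrite mul1r gt_eqF//; have := ler0n R j; have := ler0n R k0; move: a1; lra.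
have [s [b0 bS]] := @partial_sums _ _ (fun j => 1 * j%:R - k0%:R) beta A0.
have sk j : (j <= k0)%N -> s j = 0.
  elim: j => [|j IH] jk.
    by apply: (mulfI (A0 0)); rewrite -b0 bk// mulr0.
  apply: (mulfI (A0 j.+1)); rewrite mulr0 -(bk _ jk) bS IH ?mulr0 ?addr0//.
  exact: ltnW.
(* At k0 only the boundary term of the moment form is left. *)
have sN : s N.+1 = 0.
  move: Ck; have [_ ->] := forms_dual k0 b0 bS.
  rewrite (_ : k0%:R - 1 * k0%:R = 0); last by ring.
  rewrite mul0r addr0 => /eqP; rewrite -!mulrA mulf_eq0 (negPf (A0 _)).
  rewrite /moment_ker k0N mul1r /= !mulf_eq0 signr_eq0 invr_eq0 (negPf (fact_neq0R _ _)).
  by rewrite gt_eqF ?Gam_gt0//=; [move/eqP|have := ler0n R (N.+1 + k0); move: a1; lra].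
have s0 : forall j, (j < N.+1)%N -> s j = 0.
  apply: (dual_trivial a1) => k kN.
  (* At k = k0 the moment side carries the factor v - u k = 0, but the Taylor
     side vanishes since s is 0 up to k0. *)
  have [->|kk0] := eqVneq k k0.
    rewrite big1 ?mul0r// => j _; have [jk|kj] := leqP j k0.
      by rewrite sk// mulr0 mul0r.
    by rewrite /taylor_dual leqNgt kj mul0r mulr0.
  have := complementary kN; have [-> ->] := forms_dual k b0 bS.
  rewrite sN !mulr0 !add0r => /eqP.
  rewrite !mulf_eq0 mul1r (_ : k0%:R - 1 * k%:R = k0%:R - k%:R) ?mul1r//.
  rewrite subr_eq0 eqr_nat [k0 == k]eq_sym (negPf kk0) /= gt_eqF/=; last first.
    by have := ler0n R k; have := ler0n R k0; move: a1; lra.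
  by case/orP => /eqP ->; rewrite ?mul0r ?mulr0.
have s00 j : (j < N.+2)%N -> s j = 0.
  by rewrite ltnS leq_eqVlt => /predU1P[->//|/s0].
case=> [_|j jN]; first by rewrite b0 s00// mulr0.
by rewrite bS !s00 ?mulr0 ?addr0// ltnW.
Qed.

End Core.

(** * The basis adapted to the masses *)

Lemma gbinom_opp (R : realType) (s m : nat) :
  (-1) ^+ m * gbinom (- s.+1%:R : R) m = (s + m)`!%:R / (s`!%:R * m`!%:R).
Proof.
have f0 := fact_neq0R R.
elim: m => [|m IH].
  rewrite expr0 mul1r /gbinom big_ord0 fact0 addn0.
  by rewrite !mulr1 !divff// fact0 oner_neq0.
have m0 : m.+1%:R != 0 :> R by rewrite pnatr_eq0.
apply: (mulIf m0); rewrite -mulrA gbinomS addnS !factS !natrM.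
rewrite exprS (_ : _ * (_ * _) =
  ((-1) ^+ m * gbinom (- s.+1%:R) m) * (s.+1%:R + m%:R)); last by ring.
rewrite IH; have := f0 s; have := f0 m; move: m0.
rewrite -!natr1 natrD; move: (s`!%:R) (m`!%:R) ((s + m)`!%:R) => A B C.
by move=> nm nB nA; field; rewrite nA nB nm.
Qed.

Definition sobolev_basis (R : realType) (a : R) (n j : nat) : {poly R} :=
  'X^j * laguerre_poly (a + (2 * j)%:R) (n - j).

(** The dependence on both n and j that remains in the Taylor coefficients of the
    basis functions once their moments have been freed of it by rescaling. *)
Definition laguerre_norm_ratio (R : realType) (a : R) (n j : nat) : R :=
  (n - j)`!%:R * Gam (a + (n + j)%:R + 1) / (n`!%:R * Gam (a + n%:R + 1)).

Definition laguerre_scale (R : realType) (a : R) (n : nat) : R :=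
  Num.sqrt (n`!%:R * Gam (a + n%:R + 1) / Gam (a + 1)).

Definition limit_scale (R : realType) (a : R) (j : nat) : R :=
  Num.sqrt (Gam (a + (2 * j)%:R + 1) / Gam (a + 1)).

Section Basis.
Variables (R : realType) (a : R).
Hypothesis a1 : -1 < a.

Let g0 (n : nat) : 0 < a + n%:R + 1.
Proof. by have := ler0n R n; move: a1; lra. Qed.

Let g00 : 0 < a + 1. Proof. by move: a1; lra. Qed.

Let a2 (j : nat) : -1 < a + (2 * j)%:R.
Proof. by have := g0 (2 * j); lra. Qed.

Let fact0 (n : nat) : 0 < n`!%:R :> R.
Proof. by rewrite ltr0n fact_gt0. Qed.

(** The point of [moment_ker] is that n and j only interact through (n - j)!, which is
    absorbed in the rescaling of the coefficients. *)
Lemma sobolev_basis_moment_lt (n k j : nat) : (k < n)%N -> (j <= n)%N ->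
  laguerre_moment a (sobolev_basis a n j * 'X^k) =
  (-1) ^+ j * moment_ker a k j * ((n - k.+1)`!%:R / ((n - j)`!%:R * Gam (a + 1))).
Proof.
move=> kn jn; rewrite /sobolev_basis mulrAC -exprD.
rewrite (@laguerre_moment_Xn_laguerre _ a (a + (2 * j)%:R) (k%:R - j%:R)
  (j + k))//; first last.
- by rewrite natrD natrM; ring.
- by rewrite (_ : _ + _ = a + (j + k)%:R + 1)// natrD natrM; ring.
rewrite (_ : a + (2 * j)%:R + (k%:R - j%:R) + 1 = a + (j + k)%:R + 1); last first.
  by rewrite natrD natrM; ring.
rewrite /moment_ker; have [jk|kj] := leqP j k.
  rewrite -natrB// gbinom_small; last by lia.
  by rewrite !mul0r !mulr0 !mul0r.
rewrite (_ : k%:R - j%:R = - (j - k.+1).+1%:R); last first.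
  by rewrite subnSK// natrB 1?ltnW//; ring.
rewrite gbinom_opp (_ : (j - k.+1 + (n - j) = n - k.+1)%N); last by lia.
(* The two sides carry different powers of (-1)^j; inserting its square makes them
   equal as rational expressions. *)
have := sqrr_sign R j; rewrite expr2.
have := fact_neq0R R (j - k.+1); have := fact_neq0R R (n - j).
have := lt0r_neq0 (Gam_gt0 g00).
move: (Gam (a + 1)) (Gam _) ((j - k.+1)`!%:R) ((n - j)`!%:R) ((n - k.+1)`!%:R).
move: ((-1) ^+ j) => s A B C D E nA nD nC ss.
have ssw w : s * s * w = w by rewrite ss mul1r.
by rewrite -[LHS]ssw /=; field; rewrite nA nC nD.
Qed.

Lemma sobolev_basis_moment_eq (n j : nat) : (j <= n)%N ->
  laguerre_moment a (sobolev_basis a n j * 'X^n) =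
  (-1) ^+ n * (-1) ^+ j * (Gam (a + (n + j)%:R + 1) / Gam (a + 1)).
Proof.
move=> jn; rewrite /sobolev_basis [_ * 'X^n]mulrAC -['X^j * 'X^n]exprD.
rewrite (@laguerre_moment_Xn_laguerre _ a (a + (2 * j)%:R) (n%:R - j%:R)
  (j + n))//; first last.
- by rewrite natrD natrM; ring.
- by rewrite (_ : _ + _ = a + (j + n)%:R + 1)// natrD natrM; ring.
rewrite (_ : a + (2 * j)%:R + (n%:R - j%:R) + 1 = a + (n + j)%:R + 1); last first.
  by rewrite natrD natrM; ring.
by rewrite -natrB// gbinom_nat// binn mulr1 -signr_odd oddB// signr_addb !signr_odd.
Qed.

Lemma sobolev_basis_coef (n k j : nat) : (k <= n)%N -> (j <= n)%N ->
  (sobolev_basis a n j)`_k = (-1) ^+ k * (-1) ^+ j * taylor_ker a k j *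
    (Gam (a + (n + j)%:R + 1) / (n - k)`!%:R).
Proof.
move=> kn jn; rewrite /sobolev_basis coefXnM /taylor_ker ltnNge.
have [jk|kj] := leqP j k; last by rewrite /= !mul0r mulr0 mul0r.
rewrite /= coef_poly ltnS leq_sub2r// -signr_odd oddB// signr_addb !signr_odd.
rewrite (_ : (n - j - (k - j) = n - k)%N); last by lia.
rewrite (_ : a + (2 * j)%:R + (n - j)%:R + 1 = a + (n + j)%:R + 1); last first.
  by rewrite natrB// natrD natrM; ring.
rewrite (_ : a + (2 * j)%:R + (k - j)%:R + 1 = a + (j + k)%:R + 1); last first.
  by rewrite natrB// natrD natrM; ring.
have := fact_neq0R R (k - j); have := fact_neq0R R (n - k).
have := lt0r_neq0 (Gam_gt0 (g0 (j + k)%N)).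
move: (Gam _) (Gam _) ((k - j)`!%:R) ((n - k)`!%:R) => A B C D nA nD nC.
by field; rewrite nA nC nD.
Qed.

Lemma laguerre_norm_ratio_gt0 (n j : nat) : 0 < laguerre_norm_ratio a n j.
Proof. by rewrite /laguerre_norm_ratio divr_gt0 ?mulr_gt0 ?Gam_gt0. Qed.

Lemma laguerre_scale_gt0 (n : nat) : 0 < laguerre_scale a n.
Proof. by rewrite /laguerre_scale sqrtr_gt0 divr_gt0 ?mulr_gt0 ?Gam_gt0. Qed.

Lemma limit_scale_gt0 (j : nat) : 0 < limit_scale a j.
Proof. by rewrite /limit_scale sqrtr_gt0 divr_gt0 ?Gam_gt0. Qed.

Lemma sobolev_basis_norm (n j : nat) : (j <= n)%N ->
  (Num.sqrt (laguerre_ip (a + (2 * j)%:R) (laguerre_poly (a + (2 * j)%:R) (n - j))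
    (laguerre_poly (a + (2 * j)%:R) (n - j))))^-1 =
  limit_scale a j * (n - j)`!%:R /
    (laguerre_scale a n * Num.sqrt (laguerre_norm_ratio a n j)).
Proof.
move=> jn; rewrite laguerre_poly_norm2//.
rewrite (_ : a + (2 * j)%:R + (n - j)%:R + 1 = a + (n + j)%:R + 1); last first.
  by rewrite natrB// natrD natrM; ring.
set x := _^-1; set y := (RHS).
have x0 : 0 <= x by rewrite invr_ge0 sqrtr_ge0.
have y0 : 0 <= y.
  by rewrite divr_ge0 ?mulr_ge0 ?ler0n ?sqrtr_ge0.
apply/eqP; rewrite -(@eqrXn2 _ 2)// /x /y.
have h1 : 0 <= Gam (a + (n + j)%:R + 1) /
    ((n - j)`!%:R * Gam (a + (2 * j)%:R + 1)).
  by rewrite ltW// divr_gt0 ?mulr_gt0 ?Gam_gt0.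
have h2 : 0 <= Gam (a + (2 * j)%:R + 1) / Gam (a + 1).
  by rewrite ltW// divr_gt0 ?Gam_gt0.
have h3 : 0 <= n`!%:R * Gam (a + n%:R + 1) / Gam (a + 1).
  by rewrite ltW// divr_gt0 ?mulr_gt0 ?Gam_gt0.
rewrite exprVn !exprMn exprVn exprMn /limit_scale /laguerre_scale.
rewrite !sqr_sqrtr//; last first.
  by rewrite ltW// laguerre_norm_ratio_gt0.
rewrite /laguerre_norm_ratio.
have := fact_neq0R R n; have := fact_neq0R R (n - j).
have := lt0r_neq0 (Gam_gt0 (g0 (n + j))).
have := lt0r_neq0 (Gam_gt0 (g0 n)).
have := lt0r_neq0 (Gam_gt0 (g0 (2 * j))).
have := lt0r_neq0 (Gam_gt0 g00).
move: (Gam (a + 1)) (Gam (a + n%:R + 1)) (Gam _) (Gam _) ((n - j)`!%:R) (n`!%:R).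
move=> A B C D E F nA nD nB nC nE nF; apply/eqP.
by field; rewrite nA nB nC nD nE nF.
Qed.

End Basis.

(** * The equations satisfied by the coefficients *)

Section SobolevProduct.
Variables (R : realType) (a : R) (N : nat) (M : 'I_N.+1 -> R).
Hypothesis a1 : -1 < a.

Lemma sobolev_ipC (p q : {poly R}) : sobolev_ip a M p q = sobolev_ip a M q p.
Proof.
rewrite /sobolev_ip laguerre_ipC; congr (_ + _).
by apply: eq_bigr => j _; rewrite mulrAC.
Qed.

Lemma sobolev_ipDl (p1 p2 q : {poly R}) :
  sobolev_ip a M (p1 + p2) q = sobolev_ip a M p1 q + sobolev_ip a M p2 q.
Proof.
rewrite /sobolev_ip laguerre_ipDl// addrACA -big_split/=; congr (_ + _).
by apply: eq_bigr => j _; rewrite derivnD hornerD mulrDr mulrDl.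
Qed.

Lemma sobolev_ipZl (c : R) (p q : {poly R}) :
  sobolev_ip a M (c *: p) q = c * sobolev_ip a M p q.
Proof.
rewrite /sobolev_ip laguerre_ipZl// mulrDr mulr_sumr; congr (_ + _).
by apply: eq_bigr => j _; rewrite derivnZ hornerZ; ring.
Qed.

Lemma horner0_derivn (p : {poly R}) (k : nat) : p^`(k).[0] = p`_k * k`!%:R.
Proof. by rewrite horner_coef0 coef_derivn addn0 ffactnn mulr_natr. Qed.

(** Testing against monomials diagonalizes the discrete part of the product. *)
Lemma sobolev_ip_Xn (p : {poly R}) (k : 'I_N.+1) :
  sobolev_ip a M p 'X^k = laguerre_moment a (p * 'X^k) + M k * k`!%:R ^+ 2 * p`_k.
Proof.
rewrite /sobolev_ip laguerre_ip_moment// (bigD1 k)//= big1 ?addr0.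
  by rewrite !horner0_derivn coefXn eqxx /=; ring.
move=> j jk; rewrite !horner0_derivn coefXn.
have -> : (j == k :> nat) = false by exact: negPf jk.
by rewrite mul0r mulr0.
Qed.

Lemma sobolev_ip_Xn_gt (p : {poly R}) (k : nat) : (N < k)%N ->
  sobolev_ip a M p 'X^k = laguerre_moment a (p * 'X^k).
Proof.
move=> Nk; rewrite /sobolev_ip laguerre_ip_moment// big1 ?addr0// => j _.
rewrite !horner0_derivn coefXn.
have -> : (j == k :> nat) = false by rewrite ltn_eqF// (leq_trans (ltn_ord j)).
by rewrite mul0r mulr0.
Qed.

Hypothesis M0 : forall j, 0 <= M j.

Lemma sobolev_ip_gt0 (p : {poly R}) : p != 0 -> 0 < sobolev_ip a M p p.
Proof.
move=> p0; rewrite /sobolev_ip ltr_wpDr ?laguerre_ip_gt0//.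
by apply: sumr_ge0 => j _; rewrite -mulrA mulr_ge0// -expr2 sqr_ge0.
Qed.

(** The last claim is the norm equation: q differs from q`_n x^n by a polynomial of
    smaller degree, which is orthogonal to q. *)
Lemma normalize_orthopoly (Q : {poly R}) (n : nat) :
  is_orthopoly (sobolev_ip a M) n Q ->
  let q := normalize (sobolev_ip a M) Q in
  [/\ exists2 c, 0 < c & lead_coef q = c * lead_coef Q,
      forall p : {poly R}, (size p <= n)%N -> sobolev_ip a M q p = 0
    & q`_n * sobolev_ip a M q 'X^n = 1].
Proof.
move=> [sQ orth] q.
have Q0 : Q != 0 by rewrite -size_poly_eq0 sQ.
have QQ0 := sobolev_ip_gt0 Q0.
have c0 : 0 < (Num.sqrt (sobolev_ip a M Q Q))^-1 by rewrite invr_gt0 sqrtr_gt0.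
set c := _^-1 in c0.
have qE : q = c *: Q by [].
clearbody q.
have qorth (p : {poly R}) : (size p <= n)%N -> sobolev_ip a M q p = 0.
  by move=> pn; rewrite qE sobolev_ipZl orth// mulr0.
have sq : size q = n.+1 by rewrite qE size_scale ?gt_eqF.
split => //; first by exists c => //; rewrite qE lead_coefZ.
have qq : sobolev_ip a M q q = 1.
  rewrite qE sobolev_ipZl sobolev_ipC sobolev_ipZl mulrA -expr2 /c exprVn.
  by rewrite sqr_sqrtr ?mulVf// ?gt_eqF// ltW.
rewrite -[RHS]qq.
have r0 : sobolev_ip a M (q - q`_n *: 'X^n) q = 0.
  rewrite sobolev_ipC qorth//.
  apply/leq_sizeP => j; rewrite leq_eqVlt coefB (coefZ _ 'X^n) coefXn => /predU1P[<-|nj].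
    by rewrite eqxx mulr1 subrr.
  by rewrite nth_default ?sq// gtn_eqF// mulr0 subr0.
rewrite -[X in _ = sobolev_ip _ _ X _](subrK (q`_n *: 'X^n)).
by rewrite sobolev_ipDl r0 add0r sobolev_ipZl [X in _ = _ * X]sobolev_ipC.
Qed.

End SobolevProduct.

Section Equations.
Variables (R : realType) (a : R) (N n : nat) (beta : nat -> R).
Hypothesis a1 : -1 < a.
Hypothesis Nn : (N < n)%N.

Definition basis_comb : {poly R} := \sum_(j < N.+2)
  ((-1) ^+ j * beta j * (n - j)`!%:R / laguerre_scale a n) *: sobolev_basis a n j.

Let g0 (m : nat) : 0 < a + m%:R + 1.
Proof. by have := ler0n R m; move: a1; lra. Qed.

Let g00 : 0 < a + 1. Proof. by move: a1; lra. Qed.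

Let jn (j : 'I_N.+2) : (j <= n)%N.
Proof. by rewrite (leq_trans _ Nn)// -ltnS. Qed.

Let ssw (j : nat) (w : R) : (-1) ^+ j * (-1) ^+ j * w = w.
Proof. by rewrite -expr2 sqrr_sign mul1r. Qed.

Lemma basis_comb_moment_lt (k : nat) : (k < n)%N ->
  laguerre_moment a (basis_comb * 'X^k) =
  (n - k.+1)`!%:R / (laguerre_scale a n * Gam (a + 1)) * moment_form a N.+2 k beta.
Proof.
move=> kn; rewrite /basis_comb mulr_suml laguerre_moment_sum /moment_form mulr_sumr.
apply: eq_bigr => j _; rewrite -scalerAl laguerre_momentZ sobolev_basis_moment_lt//.
rewrite -[LHS](ssw j).
have := fact_neq0R R (n - j); have := lt0r_neq0 (Gam_gt0 g00).
have := lt0r_neq0 (laguerre_scale_gt0 a1 n).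
move: (laguerre_scale a n) (Gam _) ((n - j)`!%:R) (moment_ker _ _ _) => A B C D nA nB nC.
have := ssw j 1; rewrite mulr1; move: ((-1) ^+ j) => s ss.
transitivity (s * s * (s * s) * (beta j * D * (n - k.+1)`!%:R / (A * B))).
  by field; rewrite nA nB nC.
by rewrite ss !mul1r; field; rewrite nA nB.
Qed.

Lemma basis_comb_moment_eq :
  laguerre_moment a (basis_comb * 'X^n) =
  (-1) ^+ n * laguerre_scale a n * \sum_(j < N.+2) laguerre_norm_ratio a n j * beta j.
Proof.
rewrite /basis_comb mulr_suml laguerre_moment_sum mulr_sumr.
apply: eq_bigr => j _; rewrite -scalerAl laguerre_momentZ sobolev_basis_moment_eq//.
have K2 : laguerre_scale a n ^+ 2 = n`!%:R * Gam (a + n%:R + 1) / Gam (a + 1).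
  by rewrite /laguerre_scale sqr_sqrtr// ltW// divr_gt0 ?mulr_gt0 ?Gam_gt0
    ?ltr0n ?fact_gt0.
rewrite /laguerre_norm_ratio.
have := fact_neq0R R n; have := lt0r_neq0 (Gam_gt0 g00).
have := lt0r_neq0 (laguerre_scale_gt0 a1 n); have := lt0r_neq0 (Gam_gt0 (g0 n)).
move: K2.
move: (laguerre_scale a n) (Gam (a + 1)) ((n - j)`!%:R) (n`!%:R) (Gam (a + n%:R + 1)).
move=> K A B C D K2 nD nK nA nC.
have := ssw j 1; rewrite mulr1; move: (Gam _) ((-1) ^+ j) ((-1) ^+ n) => E s s' ss.
apply: (mulIf nK); rewrite -[_ / K * _ * K]mulrA.
transitivity (s * s * (beta j * B * s' * E / A)).
  by field; rewrite nA nK.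
rewrite ss mul1r.
transitivity (s' * K ^+ 2 * (B * E / (C * D) * beta j)); last by ring.
by rewrite K2; field; rewrite nA nC nD.
Qed.

Lemma basis_comb_coef (k : nat) : (k <= n)%N ->
  basis_comb`_k = (-1) ^+ k *
    (n`!%:R * Gam (a + n%:R + 1) / ((n - k)`!%:R * laguerre_scale a n))
    *
    taylor_form a N.+2 k (fun j => laguerre_norm_ratio a n j * beta j).
Proof.
move=> kn; rewrite /basis_comb coef_sum mulr_sumr.
apply: eq_bigr => j _; rewrite coefZ sobolev_basis_coef// /laguerre_norm_ratio.
have := fact_neq0R R n; have := fact_neq0R R (n - k).
have := lt0r_neq0 (laguerre_scale_gt0 a1 n); have := lt0r_neq0 (Gam_gt0 (g0 n)).
move: (laguerre_scale a n) (taylor_ker _ _ _) ((n - j)`!%:R) ((n - k)`!%:R) (n`!%:R).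
move: (Gam (a + n%:R + 1)) (Gam (a + (n + j)%:R + 1)) ((-1) ^+ k).
move=> A B s' K T F G H nA nK nG nH.
have := ssw j 1; rewrite mulr1; move: ((-1) ^+ j) => s ss.
transitivity (s * s * (beta j * F / K * s' * T * (B / G))).
  by field; rewrite nK nG.
by rewrite ss mul1r; field; rewrite nK nG nA nH.
Qed.

Lemma basis_comb_lead :
  basis_comb`_n = (-1) ^+ n / laguerre_scale a n * \sum_(j < N.+2) beta j.
Proof.
rewrite basis_comb_coef// subnn fact0 mul1r /taylor_form !mulr_sumr.
apply: eq_bigr => j _; rewrite /laguerre_norm_ratio /taylor_ker jn (addnC j n).
have := fact_neq0R R n; have := fact_neq0R R (n - j).
have := lt0r_neq0 (laguerre_scale_gt0 a1 n); have := lt0r_neq0 (Gam_gt0 (g0 n)).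
have := lt0r_neq0 (Gam_gt0 (g0 (n + j))).
move: (laguerre_scale a n) ((n - j)`!%:R) (n`!%:R) (Gam (a + n%:R + 1)) (Gam _).
by move=> A B C D E nE nD nA nB nC /=; field; rewrite nE nD nA nB nC.
Qed.

End Equations.

(** * Asymptotics *)

Lemma cvg_sum_ord (R : realType) (n : nat) (f : 'I_n -> nat -> R) (l : 'I_n -> R) :
  (forall i, f i m @[m --> \oo] --> l i) ->
  \sum_(i < n) f i m @[m --> \oo] --> \sum_(i < n) l i.
Proof. by move=> fl; apply: cvg_big => //; exact: add_continuous. Qed.

Lemma cvg_det (R : realType) (n : nat) (A : nat -> 'M[R]_n) (A' : 'M[R]_n) :
  (forall i j, A m i j @[m --> \oo] --> A' i j) ->
  \det (A m) @[m --> \oo] --> \det A'.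
Proof.
move=> AA'; rewrite /determinant; apply: cvg_big => [|s _].
  exact: add_continuous.
apply: cvgM; first exact: cvg_cst.
by apply: cvg_big => // ; exact: mul_continuous.
Qed.

Lemma cvg_adj (R : realType) (n : nat) (A : nat -> 'M[R]_n) (A' : 'M[R]_n) :
  (forall i j, A m i j @[m --> \oo] --> A' i j) ->
  forall i j, \adj (A m) i j @[m --> \oo] --> \adj A' i j.
Proof.
move=> AA' i j; rewrite mxE; under eq_fun do rewrite mxE.
rewrite /cofactor; apply: cvgM; first exact: cvg_cst.
apply: cvg_det => k l; rewrite !mxE; under eq_fun do rewrite !mxE.
exact: AA'.
Qed.

Lemma inv_shift_cvg (R : realType) (j : nat) :
  (n - j)%:R^-1 @[n --> \oo] --> (0 : R).
Proof.
rewrite -(cvg_shiftn j.+1 (fun n => (n - j)%:R^-1 : R)).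
under eq_fun do rewrite addnS subSn ?leq_addl// addnK.
exact: cvg_harmonic.
Qed.

Lemma laguerre_norm_ratio_cvg (R : realType) (a : R) (j : nat) : -1 < a ->
  laguerre_norm_ratio a n j @[n --> \oo] --> (1 : R).
Proof.
move=> a1.
have g0 (m : nat) : 0 < a + m%:R + 1 by have := ler0n R m; lra.
elim: j => [|j IH].
  apply: cvg_near_cst; apply: nearW => n.
  rewrite /laguerre_norm_ratio subn0 addn0 divff// mulf_neq0 ?fact_neq0R//.
  by rewrite gt_eqF ?Gam_gt0.
have lim : laguerre_norm_ratio a n j * (1 + (a + 1 + 2 * j%:R) * (n - j)%:R^-1)
    @[n --> \oo] --> (1 * (1 + (a + 1 + 2 * j%:R) * 0) : R).
  apply: cvgM => //; apply: cvgD; first exact: cvg_cst.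
  by apply: cvgM; [exact: cvg_cst|exact: inv_shift_cvg].
rewrite mulr0 addr0 mulr1 in lim; apply: cvg_trans lim.
apply: near_eq_cvg; near=> n.
have jn : (j < n)%N by near: n; exact: nbhs_infty_gt.
rewrite /laguerre_norm_ratio addnS -(natr1 (n + j)%N) addrA (GamS (g0 (n + j))).
rewrite -(subnSK jn) factS natrM.
have nE : n%:R = j%:R + 1 + (n - j.+1)%:R :> R by rewrite natrB// -(natr1 j); ring.
have : (n - j.+1).+1%:R != 0 :> R by rewrite pnatr_eq0.
have := lt0r_neq0 (Gam_gt0 (g0 n)); have := fact_neq0R R n.
move: (Gam _) (n`!%:R) (Gam _) ((n - j.+1)`!%:R) => A B C D nB nA.
rewrite -(natr1 (n - j.+1)%N) natrD nE; move: ((n - j.+1)%:R) => d nd.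
by field; rewrite nA nB nd.
Unshelve. all: by end_near. Qed.

Definition mass_growth (R : realType) (a : R) (n k : nat) : R :=
  n`!%:R * Gam (a + n%:R + 1) * Gam (a + 1) / ((n - k)`!%:R * (n - k.+1)`!%:R).

(** Passing from m to m + 1 multiplies the quotient by 1 + (a + 1)/(m + 1), and a
    product of factors 1 + x_i with x_i >= 0 is at least 1 + sum x_i. *)
Lemma gamma_quotient_ge (R : realType) (a : R) (m : nat) : -1 < a ->
  Gam (a + 2) * ((a + 1) * series harmonic m) <= Gam (a + m.+1%:R + 1) / m`!%:R.
Proof.
move=> a1.
have G0 : 0 < Gam (a + 2) by apply: Gam_gt0; lra.
suff : Gam (a + 2) * (1 + (a + 1) * series harmonic m) <=
    Gam (a + m.+1%:R + 1) / m`!%:R.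
  by apply: le_trans; rewrite ler_wpM2l ?(ltW G0)// lerDr.
elim: m => [|m IH].
  rewrite /series/= big_geq// mulr0 addr0 mulr1 fact0 divr1.
  by rewrite (_ : a + 1 + 1 = a + 2)//; ring.
have s0 : 0 <= series harmonic m :> R.
  by rewrite /series/= sumr_ge0// => i _; rewrite invr_ge0.
have gm : 0 < a + m.+1%:R + 1 by have := ler0n R m.+1; lra.
have -> : series harmonic m.+1 = series harmonic m + m.+1%:R^-1 :> R.
  by rewrite /series/= big_nat_recr.
have -> : Gam (a + m.+2%:R + 1) / m.+1`!%:R =
    Gam (a + m.+1%:R + 1) / m`!%:R * (1 + (a + 1) * m.+1%:R^-1).
  rewrite -(natr1 m.+1) addrA (GamS gm) factS natrM.
  have := fact_neq0R R m; have : m.+1%:R != 0 :> R by rewrite pnatr_eq0.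
  move: (Gam _) => A; move: (m`!%:R) (m.+1%:R) => B C nC nB.
  by field; rewrite nC nB.
have v0 : 0 <= m.+1%:R^-1 :> R by rewrite invr_ge0.
apply: le_trans (ler_wpM2r _ IH); last by rewrite addr_ge0// mulr_ge0//; lra.
rewrite -mulrA ler_wpM2l ?(ltW G0)//.
move: (series harmonic m) (m.+1%:R^-1) s0 v0 => s v s0 v0.
have : 0 <= (a + 1) * s * ((a + 1) * v) by rewrite !mulr_ge0//; lra.
lra.
Qed.

Lemma mass_growth_ge (R : realType) (a : R) (m k : nat) : -1 < a -> (k <= m)%N ->
  Gam (a + 1) * (Gam (a + 2) * ((a + 1) * series harmonic m)) <=
  mass_growth a m.+1 k.
Proof.
move=> a1 km.
have g0 (i : nat) : 0 < a + i%:R + 1 by have := ler0n R i; lra.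
have G0 : 0 < Gam (a + 1) by apply: Gam_gt0; lra.
apply: (le_trans (ler_wpM2l (ltW G0) (gamma_quotient_ge m a1))).
rewrite /mass_growth [leRHS](_ : _ =
  Gam (a + 1) * (Gam (a + m.+1%:R + 1) / m`!%:R) *
  ((m.+1`!%:R / (m.+1 - k)`!%:R) * (m`!%:R / (m - k)`!%:R))); last first.
  rewrite subSS; have := fact_neq0R R m; have := fact_neq0R R (m.+1 - k).
  have := fact_neq0R R (m - k).
  move: (Gam _) (Gam _) (m`!%:R) (m.+1`!%:R) ((m - k)`!%:R) ((m.+1 - k)`!%:R).
  by move=> A B C D E F nE nF nC; field; rewrite nE nF nC.
have f0 i : 0 < i`!%:R :> R by rewrite ltr0n fact_gt0.
have fle i j : (i <= j)%N -> 1 <= j`!%:R / i`!%:R :> R.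
  by move=> ij; rewrite ler_pdivlMr// mul1r ler_nat; exact: leq_fact.
apply: ler_peMr; last by apply: mulr_ege1; apply: fle; exact: leq_subr.
by apply: mulr_ge0; [exact: ltW|apply: divr_ge0; apply: ltW; [exact: Gam_gt0|]].
Qed.

Lemma series_harmonic_cvgy (R : realType) : series (@harmonic R) n @[n --> \oo] --> +oo.
Proof.
apply: nondecreasing_dvgn_lt; last exact: dvg_harmonic.
apply/nondecreasing_seqP => n; rewrite /series/= big_nat_recr//= lerDl.
by rewrite invr_ge0.
Qed.

(** This is where a > -1 forces the Taylor conditions to dominate: the growth is
    bounded below by the harmonic series. *)
Lemma mass_growth_cvgV (R : realType) (a : R) (k : nat) : -1 < a ->
  (mass_growth a n k)^-1 @[n --> \oo] --> (0 : R).
Proof.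
move=> a1.
have g0 (i : nat) : 0 < a + i%:R + 1 by have := ler0n R i; lra.
have f0 i : 0 < i`!%:R :> R by rewrite ltr0n fact_gt0.
have l0 n : 0 < mass_growth a n k.
  by rewrite /mass_growth divr_gt0 ?mulr_gt0 ?Gam_gt0//; lra.
apply/gtr0_cvgV0; first exact: nearW.
rewrite -(cvg_shiftS (fun n => mass_growth a n k)).
pose c := Gam (a + 1) * (Gam (a + 2) * (a + 1)).
have c0 : 0 < c by rewrite /c !mulr_gt0 ?Gam_gt0//; lra.
apply/cvgryPge => A; near=> n.
apply: le_trans (@mass_growth_ge R a n k a1 _); last by near: n; exact: nbhs_infty_ge.
rewrite !mulrA -(mulrA (Gam (a + 1))) -/c mulrC -ler_pdivrMr//.
near: n; move/cvgryPge: (@series_harmonic_cvgy R); exact.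
Unshelve. all: by end_near. Qed.

(** * The limit system *)

Section LimitSystem.
Variables (R : realType) (a : R) (N : nat) (M : 'I_N.+1 -> R).
Hypothesis a1 : -1 < a.

Definition limit_matrix : 'M[R]_N.+2 := \matrix_(i, j)
  if i == ord_max then 1 else
  let k : 'I_N.+1 := inord i in
  if M k == 0 then moment_ker a k j else taylor_ker a k j.

Definition mass_weight (n : nat) (k : 'I_N.+1) : R :=
  M k * (-1) ^+ k * k`!%:R ^+ 2 * mass_growth a n k.

(** Rows with a positive mass are divided by their weight, so that all rows converge. *)
Definition system_matrix (n : nat) : 'M[R]_N.+2 := \matrix_(i, j)
  if i == ord_max then 1 else
  let k : 'I_N.+1 := inord i in
  if M k == 0 then moment_ker a k j else
  moment_ker a k j * (mass_weight n k)^-1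
    + taylor_ker a k j * laguerre_norm_ratio a n j.

Lemma system_matrix_cvg (i j : 'I_N.+2) :
  system_matrix n i j @[n --> \oo] --> limit_matrix i j.
Proof.
rewrite mxE; under eq_fun do rewrite mxE.
case: (i == ord_max); first exact: cvg_cst.
set k : 'I_N.+1 := inord i => /=; have [Mk|Mk] := eqVneq (M k) 0.
  exact: cvg_cst.
have w0 : (mass_weight n k)^-1 @[n --> \oo] --> (0 : R).
  rewrite /mass_weight; under eq_fun do rewrite invfM.
  rewrite -[0](mulr0 (M k * (-1) ^+ k * k`!%:R ^+ 2)^-1).
  by apply: cvgM; [exact: cvg_cst|exact: mass_growth_cvgV].
have lim : moment_ker a k j * (mass_weight n k)^-1
      + taylor_ker a k j * laguerre_norm_ratio a n j
    @[n --> \oo] --> moment_ker a k j * 0 + taylor_ker a k j * 1.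
  apply: cvgD; (apply: cvgM; first exact: cvg_cst) => //.
  exact: laguerre_norm_ratio_cvg.
by rewrite mulr0 add0r mulr1 in lim.
Qed.

Lemma limit_matrix_row (v : 'I_N.+2 -> R) (k : 'I_N.+1) :
  \sum_(j < N.+2) limit_matrix (widen_ord (leqnSn N.+1) k) j * v j =
  if M k == 0 then moment_form a N.+2 k (fun j => v (inord j))
  else taylor_form a N.+2 k (fun j => v (inord j)).
Proof.
have kN : widen_ord (leqnSn N.+1) k != ord_max.
  by rewrite -val_eqE /= ltn_eqF// ltn_ord.
have ik : inord (widen_ord (leqnSn N.+1) k) = k by apply: inord_val.
transitivity (\sum_(j < N.+2)
    (if M k == 0 then moment_ker a k j else taylor_ker a k j) * v j).
  by apply: eq_bigr => j _; rewrite mxE (negPf kN) /= ik.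
by case: (M k == 0); apply: eq_bigr => j _; rewrite inord_val.
Qed.

Lemma limit_matrix_last (v : 'I_N.+2 -> R) :
  \sum_(j < N.+2) limit_matrix ord_max j * v j = \sum_(j < N.+2) v j.
Proof. by apply: eq_bigr => j _; rewrite mxE eqxx mul1r. Qed.

Lemma limit_complementary (v : 'I_N.+2 -> R) :
  (forall k, \sum_(j < N.+2) limit_matrix (widen_ord (leqnSn N.+1) k) j * v j = 0) ->
  forall k, (k < N.+1)%N ->
  taylor_form a N.+2 k (fun j => v (inord j)) *
  moment_form a N.+2 k (fun j => v (inord j)) = 0.
Proof.
move=> v0 k kN; have := v0 (Ordinal kN); rewrite limit_matrix_row/=.
by case: (M _ == 0) => ->; rewrite ?mulr0 ?mul0r.
Qed.

(** A kernel vector satisfies the hypotheses of [sum_zero_trivial]. *)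
Lemma limit_matrix_det : \det limit_matrix != 0.
Proof.
rewrite -det_tr; apply/negP => /det0P[v /eqP v0 vA]; apply: v0.
have row0 i : \sum_(j < N.+2) limit_matrix i j * v 0 j = 0.
  have := congr1 (fun B : 'rV_N.+2 => B 0 i) vA; rewrite !mxE => vAi.
  by rewrite -[RHS]vAi; apply: eq_bigr => j _; rewrite [_^T _ _]mxE mulrC.
have T0 : \sum_(j < N.+2) v 0 (inord j) = 0.
  rewrite -[RHS](row0 ord_max) limit_matrix_last.
  by apply: eq_bigr => j _; rewrite inord_val.
have := sum_zero_trivial a1 (limit_complementary (fun k => row0 _)) T0.
move=> z; apply/rowP => j; rewrite mxE.
by have := z j (ltn_ord j); rewrite inord_val.
Qed.

Definition limit_vector (j : nat) : R :=
  \adj limit_matrix (inord j) ord_max / \det limit_matrix.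

Lemma limit_vector_eq (i : 'I_N.+2) :
  \sum_(j < N.+2) limit_matrix i j * limit_vector j = (i == ord_max)%:R.
Proof.
have := congr1 (fun B : 'M[R]_N.+2 => B i ord_max) (mul_mx_adj limit_matrix).
rewrite !mxE => E.
transitivity ((\sum_j limit_matrix i j * \adj limit_matrix j ord_max)
    / \det limit_matrix).
  by rewrite mulr_suml; apply: eq_bigr => j _; rewrite /limit_vector inord_val mulrA.
by rewrite E; case: (i == ord_max);
  rewrite ?mulr1n ?mulr0n ?mul0r// divff ?limit_matrix_det.
Qed.

Lemma limit_vector_complementary (k : nat) : (k < N.+1)%N ->
  taylor_form a N.+2 k limit_vector * moment_form a N.+2 k limit_vector = 0.
Proof.
move=> kN; have := limit_vector_eq (widen_ord (leqnSn N.+1) (Ordinal kN)).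
rewrite -val_eqE /= ltn_eqF// (limit_matrix_row (fun j => limit_vector j)).
have E f : \sum_(j < N.+2) f j * limit_vector (inord j : 'I_N.+2) =
    \sum_(j < N.+2) f j * limit_vector j.
  by apply: eq_bigr => j _; rewrite inord_val.
rewrite /moment_form /taylor_form.
by case: (M _ == 0) => /=; rewrite E => ->; rewrite ?mulr0 ?mul0r.
Qed.

Lemma limit_vector_sum : \sum_(j < N.+2) limit_vector j = 1.
Proof. by rewrite -limit_matrix_last limit_vector_eq eqxx. Qed.

Lemma limit_vector_taylor (k : 'I_N.+1) : M k != 0 ->
  taylor_form a N.+2 k limit_vector = 0.
Proof.
move=> Mk; have := limit_vector_eq (widen_ord (leqnSn N.+1) k).
rewrite -val_eqE /= ltn_eqF// (limit_matrix_row (fun j => limit_vector j)) (negPf Mk).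
by move=> E; apply: (etrans _ E); apply: eq_bigr => j _; rewrite inord_val.
Qed.

Lemma limit_vector_moment (k : 'I_N.+1) : M k = 0 ->
  moment_form a N.+2 k limit_vector = 0.
Proof.
move=> Mk; have := limit_vector_eq (widen_ord (leqnSn N.+1) k).
rewrite -val_eqE /= ltn_eqF// (limit_matrix_row (fun j => limit_vector j)) Mk eqxx.
by move=> E; apply: (etrans _ E); apply: eq_bigr => j _; rewrite inord_val.
Qed.

(** The Taylor forms are triangular with nonzero diagonal. *)
Lemma limit_vector_low (k : nat) : (k <= N.+1)%N ->
  (forall i : 'I_N.+1, (i < k)%N -> M i != 0) ->
  forall j, (j < k)%N -> limit_vector j = 0.
Proof.
move=> kN Mi; elim/ltn_ind => j IH jk.
have jN : (j < N.+1)%N by rewrite (leq_trans jk).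
have := @limit_vector_taylor (Ordinal jN) (Mi (Ordinal jN) jk).
rewrite /taylor_form (bigD1 (widen_ord (leqnSn N.+1) (Ordinal jN)))//=.
rewrite big1 ?addr0; last first.
  move=> i ij; have [ij'|ji] := ltnP i j.
    by rewrite IH ?mulr0// (ltn_trans ij').
  rewrite /taylor_ker leqNgt ltn_neqAle ji andbT.
  have -> : (j != i :> nat) by rewrite eq_sym; exact: ij.
  by rewrite !mul0r.
move/eqP; rewrite mulf_eq0 /taylor_ker leqnn subnn fact0 mulr1 => /orP[|/eqP//].
rewrite mulf_eq0 oner_eq0 invr_eq0 gt_eqF// Gam_gt0//.
by have := ler0n R (j + j); move: a1; lra.
Qed.

(** A vanishing coefficient at k0 would make [double_zero_trivial] applicable, against
    the normalization [limit_vector_sum]. *)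
Lemma limit_vector_first (k0 : 'I_N.+1) :
  is_first (fun i : 'I_N.+1 => M i = 0) k0 ->
  limit_vector k0 != 0 /\ forall j, (j < k0)%N -> limit_vector j = 0.
Proof.
move=> [Mk Mi].
have low := @limit_vector_low k0 (ltnW (ltn_ord k0))
  (fun i ik => introN eqP (Mi i ik)).
split => //; apply/negP => /eqP k00.
have := double_zero_trivial a1 limit_vector_complementary (ltn_ord k0) _
  (limit_vector_moment Mk).
have lowk j : (j <= k0)%N -> limit_vector j = 0.
  by rewrite leq_eqVlt => /predU1P[->//|/low].
move=> /(_ lowk) z; have := limit_vector_sum.
rewrite big1 => [/eqP|j _]; last exact: z.
by rewrite eq_sym oner_eq0.
Qed.

Lemma limit_vector_all : (forall i, M i != 0) ->
  forall j : 'I_N.+2, limit_vector j != 0 <-> j = ord_max.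
Proof.
move=> Mi; have low := @limit_vector_low N.+1 (leqnn _) (fun i _ => Mi i).
move=> j; split => [|->].
  apply: contra_neqP => jN; apply: low; rewrite ltn_neqAle -ltnS ltn_ord andbT.
  by apply/negP => /eqP e; apply: jN; exact: val_inj.
have := limit_vector_sum; rewrite big_ord_recr/= big1 ?add0r => [->|i _].
  exact: oner_neq0.
exact: low.
Qed.

Section Convergence.
Variable beta : nat -> nat -> R.
Hypothesis eq_row : forall n (k : 'I_N.+1), (N < n)%N ->
  moment_form a N.+2 k (beta n) +
  mass_weight n k *
    taylor_form a N.+2 k (fun j => laguerre_norm_ratio a n j * beta n j) = 0.
Hypothesis eq_norm : forall n, (N < n)%N ->
  (\sum_(j < N.+2) beta n j) *
  (\sum_(j < N.+2) laguerre_norm_ratio a n j * beta n j) = 1.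
Hypothesis sum_gt0 : forall n, (N < n)%N -> 0 < \sum_(j < N.+2) beta n j.

Lemma mass_weight_neq0 (n : nat) (k : 'I_N.+1) : M k != 0 -> mass_weight n k != 0.
Proof.
move=> Mk; have g0 (i : nat) : 0 < a + i%:R + 1 by have := ler0n R i; move: a1; lra.
rewrite /mass_weight /mass_growth !mulf_neq0 ?signr_eq0 ?expf_neq0 ?fact_neq0R//.
- by rewrite gt_eqF ?Gam_gt0.
- by rewrite gt_eqF ?Gam_gt0//; move: a1; lra.
Qed.

Lemma system_matrix_solves (n : nat) (i : 'I_N.+2) : (N < n)%N ->
  \sum_(j < N.+2) system_matrix n i j * beta n j =
  (\sum_(j < N.+2) beta n j) * (i == ord_max)%:R.
Proof.
move=> Nn; case: eqVneq => [->|iN].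
  by rewrite mulr1; apply: eq_bigr => j _; rewrite mxE eqxx mul1r.
rewrite mulr0; set k : 'I_N.+1 := inord i.
have := eq_row k Nn; have [Mk|Mk] := eqVneq (M k) 0.
  rewrite /mass_weight Mk !mul0r addr0 => E; apply: (etrans _ E).
  by apply: eq_bigr => j _; rewrite mxE (negPf iN) /= -/k Mk eqxx.
have w0 := mass_weight_neq0 n Mk => E.
have -> : \sum_(j < N.+2) system_matrix n i j * beta n j = (mass_weight n k)^-1 *
  (moment_form a N.+2 k (beta n) +
  mass_weight n k *
    taylor_form a N.+2 k (fun j => laguerre_norm_ratio a n j * beta n j)).
  rewrite mulrDr mulKf// /moment_form mulr_sumr -big_split; apply: eq_bigr => j _.
  by rewrite mxE (negPf iN) /= -/k (negPf Mk); ring.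
by rewrite E mulr0.
Qed.

Lemma system_cramer (n : nat) (j : 'I_N.+2) : (N < n)%N ->
  \det (system_matrix n) * beta n j =
  (\sum_(i < N.+2) beta n i) * \adj (system_matrix n) j ord_max.
Proof.
move=> Nn; pose c : 'cV[R]_N.+2 := \col_i beta n i.
have Ac : system_matrix n *m c = (\sum_(i < N.+2) beta n i) *: delta_mx ord_max 0.
  apply/colP => i; rewrite !mxE eqxx andbT -system_matrix_solves//.
  by apply: eq_bigr => l _; rewrite [c _ _]mxE.
have := congr1 (fun B : 'M[R]_N.+2 => (B *m c) j 0) (mul_adj_mx (system_matrix n)).
rewrite -mulmxA Ac mul_scalar_mx -scalemxAr -colE.
by rewrite [LHS]mxE [col _ _ _ _]mxE [RHS]mxE [c _ _]mxE => ->.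
Qed.

(** The sum T of the coefficients solves the quadratic equation T^2 S = det, where S is
    built from the adjugate and tends to the limit of det; positivity selects the
    root. *)
Lemma rescaled_sum_cvg : \sum_(j < N.+2) beta n j @[n --> \oo] --> (1 : R).
Proof.
pose S n := \sum_(j < N.+2) laguerre_norm_ratio a n j *
  \adj (system_matrix n) j ord_max.
have Scvg : S n @[n --> \oo] --> \det limit_matrix.
  rewrite (_ : \det _ = \sum_(j < N.+2) 1 * \adj limit_matrix j ord_max).
    apply: cvg_sum_ord => j; apply: cvgM; first exact: laguerre_norm_ratio_cvg.
    exact: cvg_adj system_matrix_cvg _ _.
  have := congr1 (fun B : 'M[R]_N.+2 => B ord_max ord_max) (mul_mx_adj limit_matrix).
  rewrite !mxE eqxx mulr1n => <-.
  by apply: eq_bigr => j _; rewrite [limit_matrix _ _]mxE eqxx.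
have Dcvg := cvg_det system_matrix_cvg.
have := limit_matrix_det => D0.
have lim : Num.sqrt (\det (system_matrix n) / S n) @[n --> \oo] --> (1 : R).
  rewrite -[1]sqrtr1 -(divff D0).
  apply: (continuous_cvg _ (@sqrt_continuous R _)).
  by apply: cvgM => //; exact: cvgV.
apply: cvg_trans lim; apply: near_eq_cvg; near=> n.
have Nn : (N < n)%N by near: n; exact: nbhs_infty_gt.
have S0 : S n != 0 by near: n; exact: cvgr_neq0 Scvg D0.
have T0 := sum_gt0 Nn.
suff -> : \det (system_matrix n) / S n = (\sum_(j < N.+2) beta n j) ^+ 2.
  by rewrite sqrtr_sqr ger0_norm// ltW.
apply: (mulIf S0); rewrite divfK// expr2 -mulrA /S [_ * (\sum_(_ < _) _ * _)]mulr_sumr.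
rewrite -[LHS]mulr1 -(eq_norm Nn) mulrCA; congr (_ * _).
rewrite mulr_sumr; apply: eq_bigr => j _.
by rewrite mulrCA system_cramer// mulrCA.
Unshelve. all: by end_near. Qed.

Lemma rescaled_coef_cvg (j : 'I_N.+2) : beta n j @[n --> \oo] --> limit_vector j.
Proof.
have D0 := limit_matrix_det.
have Dcvg := cvg_det system_matrix_cvg.
have lim : (\sum_(j < N.+2) beta n j) *
    (\adj (system_matrix n) j ord_max / \det (system_matrix n))
    @[n --> \oo] --> 1 * limit_vector j.
  apply: cvgM; first exact: rescaled_sum_cvg.
  rewrite /limit_vector inord_val; apply: cvgM; last exact: cvgV.
  exact: cvg_adj system_matrix_cvg _ _.
rewrite mul1r in lim; apply: cvg_trans lim; apply: near_eq_cvg; near=> n.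
have Nn : (N < n)%N by near: n; exact: nbhs_infty_gt.
have Dn : \det (system_matrix n) != 0 by near: n; exact: cvgr_neq0 Dcvg D0.
by apply: (mulfI Dn); rewrite system_cramer// mulrCA [\det _ * _]mulrC divfK.
Unshelve. all: by end_near. Qed.

End Convergence.
End LimitSystem.

(** * The limit of the coefficients *)

Definition rescaled_coef (R : realType) (a : R) (N : nat) (b : 'I_N.+2 -> nat -> R)
    (n j : nat) : R :=
  (-1) ^+ j * limit_scale a j * b (inord j) n / Num.sqrt (laguerre_norm_ratio a n j).

Lemma basis_comb_beta (R : realType) (a : R) (N n : nat) (b : 'I_N.+2 -> nat -> R)
    (L : R -> nat -> {poly R}) :
  -1 < a -> (N < n)%N ->
  (forall (g : R) (n : nat), -1 < g -> is_laguerre g n (L g n)) ->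
  \sum_(j < N.+2) b j n *: ('X^j *
    normalize (laguerre_ip (a + (2 * j)%:R)) (L (a + (2 * j)%:R) (n - j)%N)) =
  basis_comb a N n (rescaled_coef a b n).
Proof.
move=> a1 Nn hL; apply: eq_bigr => j _.
have jn : (j <= n)%N by rewrite (leq_trans _ Nn)// -ltnS.
have a2 : -1 < a + (2 * j)%:R by have := ler0n R (2 * j); lra.
rewrite (is_laguerre_uniq a2 (hL _ (n - j)%N a2)) /normalize sobolev_basis_norm//.
rewrite -scalerAr scalerA; congr (_ *: _); rewrite /rescaled_coef inord_val.
have := lt0r_neq0 (laguerre_scale_gt0 a1 n).
have : Num.sqrt (laguerre_norm_ratio a n j) != 0.
  by rewrite gt_eqF// sqrtr_gt0 laguerre_norm_ratio_gt0.
have := sqrr_sign R j; rewrite expr2.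
move: (Num.sqrt _) (laguerre_scale a n) (limit_scale a j) ((-1) ^+ j).
move=> A B C s ss nA nB.
have ssw w : s * s * w = w by rewrite ss mul1r.
by rewrite -[LHS]ssw; field; rewrite nA nB.
Qed.

Section System.
Variables (R : realType) (a : R) (N : nat) (M : 'I_N.+1 -> R) (n : nat).
Variables (beta : nat -> R) (Q : {poly R}).
Hypothesis a1 : -1 < a.
Hypothesis M0 : forall j, 0 <= M j.
Hypothesis Nn : (N < n)%N.
Hypothesis hQ : is_sobolev_laguerre a M (laguerre_poly a n) n Q.
Hypothesis hq : normalize (sobolev_ip a M) Q = basis_comb a N n beta.

Let g0 (m : nat) : 0 < a + m%:R + 1.
Proof. by have := ler0n R m; move: a1; lra. Qed.

Let g00 : 0 < a + 1. Proof. by move: a1; lra. Qed.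

Lemma rescaled_system_row (k : 'I_N.+1) :
  moment_form a N.+2 k beta +
  mass_weight a M n k *
    taylor_form a N.+2 k (fun j => laguerre_norm_ratio a n j * beta j) = 0.
Proof.
have [hO _] := hQ; have [_ orth _] := normalize_orthopoly a1 M0 hO.
have kn : (k < n)%N by rewrite (leq_trans (ltn_ord k)).
have := orth 'X^k; rewrite size_polyXn => /(_ kn).
rewrite hq sobolev_ip_Xn// basis_comb_moment_lt// basis_comb_coef//; last exact: ltnW.
rewrite /mass_weight /mass_growth.
have := fact_neq0R R (n - k); have := fact_neq0R R (n - k.+1).
have := lt0r_neq0 (laguerre_scale_gt0 a1 n); have := lt0r_neq0 (Gam_gt0 g00).
move: (moment_form _ _ _ _) (taylor_form _ _ _ _) => P T.
move: (laguerre_scale a n) (Gam (a + 1)) (Gam (a + n%:R + 1)).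
move: ((n - k)`!%:R) ((n - k.+1)`!%:R).
move=> C D K A B nA nK nD nC E.
have c0 : D / (K * A) != 0 by rewrite mulf_neq0// invr_eq0 mulf_neq0.
apply: (mulfI c0); rewrite mulr0; apply: (etrans _ E).
by field; rewrite nA nK nC nD.
Qed.

Lemma rescaled_system_norm :
  (\sum_(j < N.+2) beta j) *
  (\sum_(j < N.+2) laguerre_norm_ratio a n j * beta j) = 1.
Proof.
have [hO _] := hQ; have [_ _] := normalize_orthopoly a1 M0 hO.
rewrite hq sobolev_ip_Xn_gt// basis_comb_lead// basis_comb_moment_eq// => <-.
have := lt0r_neq0 (laguerre_scale_gt0 a1 n).
have := sqrr_sign R n; rewrite expr2.
move: (laguerre_scale a n) (\sum_(_ < _) _) (\sum_(_ < _) _) ((-1) ^+ n).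
move=> K T T' s ss nK.
have ssw w : s * s * w = w by rewrite ss mul1r.
by rewrite -[LHS]ssw; field.
Qed.

(** The sum has the sign of the ratio of the leading coefficients of q_n and of the
    Laguerre polynomial, which agree up to a positive factor. *)
Lemma rescaled_system_sum_gt0 : 0 < \sum_(j < N.+2) beta j.
Proof.
have [hO lQ] := hQ; have [[c c0 lq] _ _] := normalize_orthopoly a1 M0 hO.
have [sQ _] := hO.
have Q0 : Q != 0 by rewrite -size_poly_eq0 sQ.
have K0 := laguerre_scale_gt0 a1 n.
have sq : size (normalize (sobolev_ip a M) Q) = n.+1.
  rewrite /normalize size_scale// invr_eq0 gt_eqF// sqrtr_gt0.
  exact: sobolev_ip_gt0.
move: lq; rewrite lQ lead_coef_laguerre_poly// /lead_coef sq/= hq basis_comb_lead//.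
move=> E; have := sqrr_sign R n; rewrite expr2 => ss.
have -> : \sum_(j < N.+2) beta j = c * laguerre_scale a n / n`!%:R.
  move: E; have := lt0r_neq0 K0; have := fact_neq0R R n.
  move: (laguerre_scale a n) (\sum_(_ < _) _) ((-1) ^+ n) (n`!%:R) ss.
  move=> K T s F ss nF nK E.
  have ssw w : s * s * w = w by rewrite ss mul1r.
  rewrite -[LHS]ssw (_ : s * s * T = s * K * (s / K * T)); last by field.
  by rewrite E -[RHS]ssw; field.
by rewrite divr_gt0 ?mulr_gt0 ?ltr0n ?fact_gt0.
Qed.

End System.

Theorem lemma2 (R : realType) (alpha : R) (N : nat) (M : 'I_N.+1 -> R)
    (L : R -> nat -> {poly R}) (Q : nat -> {poly R})
    (b : 'I_N.+2 -> nat -> R)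
    (halpha : -1 < alpha)
    (hM : forall j : 'I_N.+1, 0 <= M j)
    (hL : forall (g : R) (n : nat), -1 < g -> is_laguerre g n (L g n))
    (hQ : forall n : nat, is_sobolev_laguerre alpha M (L alpha n) n (Q n))
    (hb : forall n : nat, (N.+1 <= n)%N ->
      normalize (sobolev_ip alpha M) (Q n) =
      \sum_(j < N.+2) b j n *: ('X^j *
        normalize (laguerre_ip (alpha + (2 * j)%:R))
          (L (alpha + (2 * j)%:R) (n - j)%N))) :
  exists B : 'I_N.+2 -> R,
    [/\ forall j : 'I_N.+2, b j n @[n --> \oo] --> B j,
        forall j : 'I_N.+1, is_first (fun i : 'I_N.+1 => M i = 0) j ->
          is_first (fun i : 'I_N.+2 => B i <> 0) (widen_ord (leqnSn N.+1) j) &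
        (forall j : 'I_N.+1, 0 < M j) ->
          forall j : 'I_N.+2, B j <> 0 <-> j = ord_max].
Proof.
pose c (j : nat) := (-1) ^+ j / limit_scale alpha j.
have c0 j : c j != 0.
  by rewrite /c mulf_neq0 ?signr_eq0// invr_eq0 gt_eqF ?limit_scale_gt0.
pose B (j : 'I_N.+2) := c j * limit_vector alpha M j.
have B0 j : B j <> 0 <-> limit_vector alpha M j != 0.
  by rewrite /B; split => [/eqP|h]; [|apply/eqP]; rewrite mulf_eq0 (negPf (c0 j)).
exists B; split.
- move=> j.
  have hq n : (N < n)%N -> normalize (sobolev_ip alpha M) (Q n) =
      basis_comb alpha N n (rescaled_coef alpha b n).
    by move=> Nn; rewrite hb// basis_comb_beta.
  have hQ' n : is_sobolev_laguerre alpha M (laguerre_poly alpha n) n (Q n).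
    by rewrite -(is_laguerre_uniq halpha (hL alpha n halpha)); exact: hQ.
  have beta_cvg := rescaled_coef_cvg halpha
    (fun n k Nn => rescaled_system_row halpha hM Nn (hQ' n) (hq n Nn) k)
    (fun n Nn => rescaled_system_norm halpha hM Nn (hQ' n) (hq n Nn))
    (fun n Nn => rescaled_system_sum_gt0 halpha hM Nn (hQ' n) (hq n Nn)) (j := j).
  have lim : c j * rescaled_coef alpha b n j * Num.sqrt (laguerre_norm_ratio alpha n j)
      @[n --> \oo] --> c j * limit_vector alpha M j * Num.sqrt 1.
    apply: cvgM; first by apply: cvgM; [exact: cvg_cst|exact: beta_cvg].
    apply: (continuous_cvg _ (@sqrt_continuous R _)).
    exact: laguerre_norm_ratio_cvg.
  rewrite sqrtr1 mulr1 in lim; apply: cvg_trans lim; apply: near_eq_cvg.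
  apply: nearW => n; rewrite /rescaled_coef inord_val /c.
  have := lt0r_neq0 (limit_scale_gt0 halpha j).
  have : Num.sqrt (laguerre_norm_ratio alpha n j) != 0.
    by rewrite gt_eqF// sqrtr_gt0 laguerre_norm_ratio_gt0.
  have := sqrr_sign R j; rewrite expr2.
  move: (Num.sqrt _) (limit_scale _ _) ((-1) ^+ j) => r s e ee nr ns.
  have eew w : e * e * w = w by rewrite ee mul1r.
  by rewrite -[RHS]eew; field; rewrite nr ns.
- move=> j /(limit_vector_first halpha) [Bj Bi]; split; first exact/B0.
  by move=> i ij; rewrite /B /= Bi// mulr0.
- move=> M0 j; rewrite B0; apply: limit_vector_all => // i.
  by rewrite gt_eqF.
Qed.
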